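(* Let $\tilde z_0\in\widetilde{\mathbb C}$ and $r\in\mathbb R$, $r>0$. Let $A=\{\tilde z\in\widetilde{\mathbb C}:|\tilde z-\tilde z_0|_{\mathrm e}<r\}$ and $u\in\widetilde{\mathcal G}_H(A)$. Then the following are equivalent: (1) $\tilde z_0$ is a strict accumulation point of generalized zeroes of $u$, i.e. of the set $\{\tilde z\in A:u(\tilde z)=0\}$; (2) $D^ku(\tilde z_0)=0$ for each $k\in\mathbb N$; (3) $u=0$ in $\widetilde{\mathcal G}(A)$.
   Context: Nets are indexed by $\varepsilon\in(0,1)$; ''for small $\varepsilon$'' means for all $\varepsilon\le\varepsilon_0$ for some $\varepsilon_0\in(0,1)$; $0\in\mathbb N$. A net $(z_\varepsilon)_\varepsilon$ in $\mathbb C$ is moderate ($\in\mathcal M_{\mathbb C}$) if there is $N\in\mathbb N$ with $|z_\varepsilon|\le\varepsilon^{-N}$ for small $\varepsilon$, and negligible ($\in\mathcal N_{\mathbb C}$) if for each $m\in\mathbb N$, $|z_\varepsilon|\le\varepsilon^m$ for small $\varepsilon$. $\widetilde{\mathbb C}=\mathcal M_{\mathbb C}/\mathcal N_{\mathbb C}$ (a ring); $[(z_\varepsilon)_\varepsilon]$ is the class of $(z_\varepsilon)_\varepsilon$. Sharp norm: for $\tilde z=[(z_\varepsilon)_\varepsilon]$, $\mathrm v(\tilde z)=\sup\{b\in\mathbb R:|z_\varepsilon|\le\varepsilon^b\text{ for small }\varepsilon\}$ and $|\tilde z|_{\mathrm e}=e^{-\mathrm v(\tilde z)}\in[0,\infty)$.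 The sharp topology on $\widetilde{\mathbb C}$ is the topology of the ultrametric $|\tilde z_1-\tilde z_2|_{\mathrm e}$. Identify $\mathbb C$ with $\mathbb R^2$. For $\emptyset\ne A\subseteq\widetilde{\mathbb C}$, $\widetilde{\mathcal G}(A)=\mathcal E_M(A)/\mathcal N(A)$, where $\mathcal E_M(A)$ (resp. $\mathcal N(A)$) is the set of nets $(u_\varepsilon)_\varepsilon$ of $C^\infty$ functions $\mathbb R^2\to\mathbb C$ such that for every $\alpha\in\mathbb N^2$ and every representative $(x_\varepsilon)_\varepsilon$ of every element of $A$, $(\partial^\alpha u_\varepsilon(x_\varepsilon))_\varepsilon\in\mathcal M_{\mathbb C}$ (resp. $\in\mathcal N_{\mathbb C}$). Operations and derivatives are $\varepsilon$-wise. Point values: $u(\tilde x)=[(u_\varepsilon(x_\varepsilon))_\varepsilon]\in\widetilde{\mathbb C}$ for $\tilde x=[(x_\varepsilon)_\varepsilon]\in A$ (well-defined). For $A\subseteq\widetilde{\mathbb C}$ open, $\widetilde{\mathcal G}_H(A)=\{u\in\widetilde{\mathcal G}(A):\bar\partial u=\frac12(\partial_x+i\partial_y)u=0\}$. For $u\in\widetilde{\mathcal G}_H(A)$, $u'=\partial_xu=-i\partial_yu$, and $D^ku$ is the $k$-th iterated derivative ($D^0u=u$). For $S\subseteq\widetilde{\mathbb C}$, $\tilde z_0\in\widetilde{\mathbb C}$ is a strict accumulation point of $S$ if for each $r\in\mathbb R$, $r>0$, there exists $\tilde z\in S$ such that $\tilde z-\tilde z_0$ is invertible in $\widetilde{\mathbb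 C}$ and $|\tilde z-\tilde z_0|_{\mathrm e}<r$. *)

(* Defs.v *)
From Stdlib Require Import Reals Lra Lia FunctionalExtensionality.
From Stdlib Require Import PropExtensionality ClassicalEpsilon ProofIrrelevance.
From Coquelicot Require Import Coquelicot.
Open Scope R_scope.

Definition quot {T : Type} (E : T -> T -> Prop) : Type :=
  {S : T -> Prop | exists x, S = E x}.

Definition cls {T : Type} {E : T -> T -> Prop} (x : T) : quot E :=
  exist _ (E x) (ex_intro _ x eq_refl).

Definition repr {T : Type} {E : T -> T -> Prop} (q : quot E) : T :=
  proj1_sig (constructive_indefinite_description _ (proj2_sig q)).

Definition is_equiv {T : Type} (E : T -> T -> Prop) : Prop :=
  (forall x, E x x) /\ (forall x y, E x y -> E y x) /\
  (forall x y z, E x y -> E y z -> E x z).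

Lemma cls_repr {T : Type} {E : T -> T -> Prop} (q : quot E) : cls (repr q) = q.
Proof.
unfold repr; destruct constructive_indefinite_description as [x Hx]; simpl.
destruct q as [S HS]; simpl in *; subst S; unfold cls; f_equal.
apply proof_irrelevance.
Qed.

Lemma cls_eq {T : Type} {E : T -> T -> Prop} (HE : is_equiv E) (x y : T) :
  @cls T E x = cls y <-> E x y.
Proof.
destruct HE as [Hr [Hs Ht]]; split.
- intros H; apply (f_equal (@proj1_sig _ _)) in H; simpl in H.
  rewrite H; apply Hr.
- intros H; assert (HE : E x = E y).
  { apply functional_extensionality; intros z; apply propositional_extensionality.
    split; intros Hz; eauto. }
  unfold cls; generalize (ex_intro (fun a => E x = E a) x eq_refl).
  generalize (ex_intro (fun a => E y = E a) y eq_refl).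
  rewrite HE; intros a b; f_equal; apply proof_irrelevance.
Qed.

Lemma repr_cls {T : Type} {E : T -> T -> Prop} (HE : is_equiv E) (x : T) :
  E (repr (@cls T E x)) x.
Proof. apply cls_eq; [exact HE | apply cls_repr]. Qed.

Record index : Type := Index { eps :> R; eps_range : 0 < eps < 1 }.

Definition for_small (P : index -> Prop) : Prop :=
  exists e0 : index, forall e : index, e <= e0 -> P e.

Definition moderate (z : index -> C) : Prop :=
  exists N : nat, for_small (fun e => Cmod (z e) <= / e ^ N).

Definition negligible (z : index -> C) : Prop :=
  forall m : nat, for_small (fun e => Cmod (z e) <= e ^ m).

Lemma for_small_all (P : index -> Prop) : (forall e, P e) -> for_small P.
Proof.
intros H; assert (Hh : 0 < / 2 < 1) by lra.
exists (Index (/ 2) Hh); auto.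
Qed.

Lemma for_small_le (a : R) : 0 < a -> for_small (fun e => e <= a).
Proof.
intros Ha; assert (H : 0 < Rmin a (/ 2) < 1).
{ split; [apply Rmin_glb_lt; lra | generalize (Rmin_r a (/ 2)); lra]. }
exists (Index _ H); simpl; intros e He; generalize (Rmin_l a (/ 2)); lra.
Qed.

Lemma for_small_and (P Q : index -> Prop) :
  for_small P -> for_small Q -> for_small (fun e => P e /\ Q e).
Proof.
intros [p Hp] [q Hq]; destruct (Rle_dec p q).
- exists p; intros e He; split; [apply Hp | apply Hq]; lra.
- exists q; intros e He; split; [apply Hp | apply Hq]; lra.
Qed.

Lemma for_small_imp (P Q : index -> Prop) :
  (forall e, P e -> Q e) -> for_small P -> for_small Q.
Proof. intros H [p Hp]; exists p; auto. Qed.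

Lemma eps_pow_pos (e : index) (n : nat) : 0 < e ^ n.
Proof. apply pow_lt, eps_range. Qed.

Lemma eps_pow_le (e : index) (m n : nat) : (m <= n)%nat -> e ^ n <= e ^ m.
Proof.
intros H; replace n with (m + (n - m))%nat by lia; rewrite pow_add.
assert (H1 : e ^ (n - m) <= 1).
{ rewrite <- (pow1 (n - m)); apply pow_incr; generalize (eps_range e); lra. }
generalize (eps_pow_pos e m); nra.
Qed.

Lemma eps_inv_pow_le (e : index) (m n : nat) :
  (m <= n)%nat -> / e ^ m <= / e ^ n.
Proof.
intros H; apply Rinv_le_contravar; [apply eps_pow_pos | now apply eps_pow_le].
Qed.

Lemma moderate_plus (z w : index -> C) :
  moderate z -> moderate w -> moderate (fun e => z e + w e)%C.
Proof.
intros [N HN] [M HM]; exists (S (max N M)).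
generalize (for_small_and _ _ (for_small_and _ _ HN HM)
  (for_small_le (/ 2) ltac:(lra))).
apply for_small_imp; intros e [[H1 H2] H3].
apply Rle_trans with (1 := Cmod_triangle _ _).
generalize (eps_inv_pow_le e N (max N M) (Nat.le_max_l _ _)); intros H4.
generalize (eps_inv_pow_le e M (max N M) (Nat.le_max_r _ _)); intros H5.
apply Rle_trans with (2 * / e ^ max N M); [lra |].
simpl; rewrite Rinv_mult; apply Rmult_le_compat_r.
- apply Rlt_le, Rinv_0_lt_compat, eps_pow_pos.
- replace 2 with (/ / 2) by lra.
  apply Rinv_le_contravar; [apply eps_range | exact H3].
Qed.

Lemma moderate_mult (z w : index -> C) :
  moderate z -> moderate w -> moderate (fun e => z e * w e)%C.
Proof.
intros [N HN] [M HM]; exists (N + M)%nat.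
generalize (for_small_and _ _ HN HM); apply for_small_imp; intros e [H1 H2].
rewrite Cmod_mult, pow_add, Rinv_mult.
apply Rmult_le_compat; auto using Cmod_ge_0.
Qed.

Lemma moderate_const (c : C) : moderate (fun _ => c).
Proof.
exists 1%nat; generalize (Cmod_ge_0 c); intros Hc.
assert (H : 0 < / (Cmod c + 1)) by (apply Rinv_0_lt_compat; lra).
generalize (for_small_le _ H); apply for_small_imp; intros e He.
rewrite pow_1; apply Rle_trans with (Cmod c + 1); [lra |].
rewrite <- (Rinv_inv (Cmod c + 1)); apply Rinv_le_contravar; [apply eps_range | exact He].
Qed.

Lemma negligible_plus (z w : index -> C) :
  negligible z -> negligible w -> negligible (fun e => z e + w e)%C.
Proof.
intros Hz Hw m.
generalize (for_small_and _ _ (for_small_and _ _ (Hz (S m)) (Hw (S m)))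
  (for_small_le (/ 2) ltac:(lra))).
apply for_small_imp; intros e [[H1 H2] H3].
apply Rle_trans with (1 := Cmod_triangle _ _); simpl in H1, H2.
generalize (eps_pow_pos e m); nra.
Qed.

Lemma negligible_mult (z w : index -> C) :
  moderate z -> negligible w -> negligible (fun e => z e * w e)%C.
Proof.
intros [N HN] Hw m; generalize (for_small_and _ _ HN (Hw (N + m)%nat)).
apply for_small_imp; intros e [H1 H2]; rewrite Cmod_mult.
apply Rle_trans with (/ e ^ N * e ^ (N + m)).
- apply Rmult_le_compat; auto using Cmod_ge_0.
- rewrite pow_add; generalize (eps_pow_pos e N); intros H.
  right; field; lra.
Qed.

Lemma negligible_0 : negligible (fun _ => RtoC 0).
Proof.
intros m; apply for_small_all; intros e; rewrite Cmod_0.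
apply Rlt_le, eps_pow_pos.
Qed.

Lemma negligible_ext (z w : index -> C) :
  (forall e, z e = w e) -> negligible z -> negligible w.
Proof. intros H; replace w with z; auto; now apply functional_extensionality. Qed.

Lemma negligible_moderate (z : index -> C) : negligible z -> moderate z.
Proof.
intros H; exists 0%nat; generalize (H 0%nat); apply for_small_imp.
intros e; simpl; lra.
Qed.

Lemma negligible_le (z w : index -> C) :
  (forall e, Cmod (z e) <= Cmod (w e)) -> negligible w -> negligible z.
Proof.
intros H Hw m; generalize (Hw m); apply for_small_imp; intros e He.
generalize (H e); lra.
Qed.

Record mnet : Type := MNet { net :> index -> C; net_moderate : moderate net }.

Definition net_equiv (z w : mnet) : Prop := negligible (fun e => z e - w e)%C.

Lemma net_equiv_is_equiv : is_equiv net_equiv.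
Proof.
unfold net_equiv; split; [| split].
- intros x; apply (negligible_ext _ _ (fun e => eq_sym (Cplus_opp_r (x e)))), negligible_0.
- intros x y H; apply negligible_le with (2 := H); intros e.
  replace (y e - x e)%C with (- (x e - y e))%C by ring; rewrite Cmod_opp; lra.
- intros x y z H1 H2; generalize (negligible_plus _ _ H1 H2).
  apply negligible_ext; intros e; ring.
Qed.

Definition gC : Type := quot net_equiv.

Definition mnet_plus (z w : mnet) : mnet :=
  MNet _ (moderate_plus z w (net_moderate z) (net_moderate w)).
Definition mnet_mult (z w : mnet) : mnet :=
  MNet _ (moderate_mult z w (net_moderate z) (net_moderate w)).
Definition mnet_const (c : C) : mnet := MNet _ (moderate_const c).
Definition mnet_opp (z : mnet) : mnet := mnet_mult (mnet_const (- (1))%C) z.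

Definition gC_plus (z w : gC) : gC := cls (mnet_plus (repr z) (repr w)).
Definition gC_mult (z w : gC) : gC := cls (mnet_mult (repr z) (repr w)).
Definition gC_opp (z : gC) : gC := cls (mnet_opp (repr z)).
Definition gC_const (c : C) : gC := cls (mnet_const c).

Lemma gC_eq (z w : mnet) : (forall e, z e = w e) -> cls z = cls w :> gC.
Proof.
intros H; apply (cls_eq net_equiv_is_equiv); unfold net_equiv.
apply negligible_ext with (2 := negligible_0); intros e; rewrite H; ring.
Qed.

Lemma gC_plus_cls (z w : mnet) : gC_plus (cls z) (cls w) = cls (mnet_plus z w).
Proof.
apply (cls_eq net_equiv_is_equiv).
generalize (negligible_plus _ _ (repr_cls net_equiv_is_equiv z)
  (repr_cls net_equiv_is_equiv w)).
apply negligible_ext; intros e; simpl; ring.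
Qed.

Lemma gC_mult_cls (z w : mnet) : gC_mult (cls z) (cls w) = cls (mnet_mult z w).
Proof.
apply (cls_eq net_equiv_is_equiv).
generalize (negligible_plus _ _
  (negligible_mult _ _ (net_moderate (repr (cls z : gC))) (repr_cls net_equiv_is_equiv w))
  (negligible_mult _ _ (net_moderate w) (repr_cls net_equiv_is_equiv z))).
apply negligible_ext; intros e; simpl; ring.
Qed.

Lemma gC_opp_cls (z : mnet) : gC_opp (cls z) = cls (mnet_opp z).
Proof.
apply (cls_eq net_equiv_is_equiv).
generalize (negligible_mult _ _ (moderate_const (- (1))%C) (repr_cls net_equiv_is_equiv z)).
apply negligible_ext; intros e; simpl; ring.
Qed.

Lemma gC_ind (P : gC -> Prop) : (forall z : mnet, P (cls z)) -> forall z, P z.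
Proof. intros H z; rewrite <- (cls_repr z); apply H. Qed.

Definition gC_AbelianMonoid_mixin : AbelianMonoid.mixin_of gC.
Proof.
apply (AbelianMonoid.Mixin gC gC_plus (gC_const 0)).
- intros x y; revert x; refine (gC_ind _ _); intros x; revert y; refine (gC_ind _ _); intros y.
  rewrite !gC_plus_cls; apply gC_eq; intros e; simpl; ring.
- intros x y z; revert x; refine (gC_ind _ _); intros x; revert y; refine (gC_ind _ _);
    intros y; revert z; refine (gC_ind _ _); intros z.
  rewrite !gC_plus_cls; apply gC_eq; intros e; simpl; ring.
- refine (gC_ind _ _); intros x; unfold gC_const.
  rewrite !gC_plus_cls; apply gC_eq; intros e; simpl; ring.
Defined.

Canonical gC_AbelianMonoid := AbelianMonoid.Pack gC gC_AbelianMonoid_mixin gC.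

Definition gC_AbelianGroup_mixin : AbelianGroup.mixin_of gC_AbelianMonoid.
Proof.
apply (AbelianGroup.Mixin gC_AbelianMonoid gC_opp).
refine (gC_ind _ _); intros x; change (gC_plus (cls x) (gC_opp (cls x)) = gC_const 0).
unfold gC_const; rewrite gC_opp_cls, gC_plus_cls; apply gC_eq; intros e; simpl; ring.
Defined.

Canonical gC_AbelianGroup := AbelianGroup.Pack gC
  (AbelianGroup.Class gC gC_AbelianMonoid_mixin gC_AbelianGroup_mixin) gC.

Definition gC_Ring_mixin : Ring.mixin_of gC_AbelianGroup.
Proof.
apply (Ring.Mixin gC_AbelianGroup gC_mult (gC_const 1)); change (AbelianGroup.sort gC_AbelianGroup) with gC.
- intros x y z; revert x; refine (gC_ind _ _); intros x; revert y; refine (gC_ind _ _);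
    intros y; revert z; refine (gC_ind _ _); intros z.
  rewrite !gC_mult_cls; apply gC_eq; intros e; simpl; ring.
- refine (gC_ind _ _); intros x; unfold gC_const.
  rewrite !gC_mult_cls; apply gC_eq; intros e; simpl; ring.
- refine (gC_ind _ _); intros x; unfold gC_const.
  rewrite !gC_mult_cls; apply gC_eq; intros e; simpl; ring.
- intros x y z; revert x; refine (gC_ind _ _); intros x; revert y; refine (gC_ind _ _);
    intros y; revert z; refine (gC_ind _ _); intros z; change plus with gC_plus.
  rewrite !gC_mult_cls, !gC_plus_cls, !gC_mult_cls; apply gC_eq; intros e; simpl; ring.
- intros x y z; revert x; refine (gC_ind _ _); intros x; revert y; refine (gC_ind _ _);
    intros y; revert z; refine (gC_ind _ _); intros z; change plus with gC_plus.
  rewrite !gC_mult_cls, !gC_plus_cls, !gC_mult_cls; apply gC_eq; intros e; simpl; ring.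
Defined.

Canonical gC_Ring := Ring.Pack gC
  (Ring.Class gC (AbelianGroup.class gC_AbelianGroup) gC_Ring_mixin) gC.

Definition invertible (z : gC) : Prop :=
  exists w : gC, mult z w = one /\ mult w z = one.

Definition net_val (z : mnet) : Rbar :=
  Lub_Rbar (fun b : R => for_small (fun e => Cmod (z e) <= Rpower e b)).

Definition val (z : gC) : Rbar := net_val (repr z).

(* The value [m_infty] does not occur, see [val_neq_m_infty]. *)
Definition sharp_norm (z : gC) : R :=
  match val z with
  | Finite v => exp (- v)
  | p_infty => 0
  | m_infty => 0
  end.

Definition sharp_ball (z0 : gC) (r : R) (z : gC) : Prop :=
  sharp_norm (minus z z0) < r.

Lemma Rpower_eps_le (e : index) (b c : R) : b <= c -> Rpower e c <= Rpower e b.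
Proof.
intros H; unfold Rpower.
assert (Hl : ln e <= 0).
{ rewrite <- ln_1; apply ln_le; generalize (eps_range e); lra. }
assert (Hle : c * ln e <= b * ln e) by nra.
destruct (Rle_lt_or_eq_dec _ _ Hle) as [H'|H'].
- now apply Rlt_le, exp_increasing.
- now rewrite H'; apply Rle_refl.
Qed.

Lemma net_val_le (z w : mnet) :
  net_equiv z w -> Rbar_le (net_val z) (net_val w).
Proof.
intros H; unfold net_val; destruct (Lub_Rbar_correct
  (fun b : R => for_small (fun e => Cmod (z e) <= Rpower e b))) as [_ Hlub].
apply Hlub; intros b Hb.
destruct (Lub_Rbar_correct
  (fun b : R => for_small (fun e => Cmod (w e) <= Rpower e b))) as [Hub _].
revert Hub; generalize (Lub_Rbar
  (fun b : R => for_small (fun e => Cmod (w e) <= Rpower e b))).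
intros l Hub.
assert (Hd : forall d, 0 < d -> Rbar_le (b - d) l).
{ intros d Hd; apply Hub.
  destruct (INR_unbounded (Rabs b + 1)) as [m Hm].
  assert (Hk : 0 < Rpower (/ 2) (/ d)) by apply exp_pos.
  generalize (for_small_and _ _ (for_small_and _ _ Hb (H m)) (for_small_le _ Hk)).
  apply for_small_imp; intros e [[H1 H2] H3].
  replace (w e) with (z e + - (z e - w e))%C by ring.
  apply Rle_trans with (1 := Cmod_triangle _ _); rewrite Cmod_opp.
  assert (H4 : e ^ m <= Rpower e b).
  { rewrite <- Rpower_pow by apply eps_range; apply Rpower_eps_le.
    generalize (Rle_abs b); lra. }
  assert (H5 : Rpower e d <= / 2).
  { apply Rle_trans with (Rpower (Rpower (/ 2) (/ d)) d).
    - apply Rle_Rpower_l; [lra | split; [apply eps_range | exact H3]].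
    - rewrite Rpower_mult, Rinv_l, Rpower_1; lra. }
  assert (H6 : Rpower e b = Rpower e (b - d) * Rpower e d).
  { rewrite <- Rpower_plus; f_equal; ring. }
  assert (H7 : 0 < Rpower e (b - d)) by apply exp_pos.
  nra. }
destruct l as [l| |]; simpl in *; auto.
- apply Rnot_lt_le; intros Hlt; generalize (Hd ((b - l) / 2) ltac:(lra)); lra.
- apply (Hd 1); lra.
Qed.

Lemma val_cls (z : mnet) : val (cls z) = net_val z.
Proof.
apply Rbar_le_antisym; apply net_val_le.
- apply (repr_cls net_equiv_is_equiv).
- apply net_equiv_is_equiv, (repr_cls net_equiv_is_equiv).
Qed.

Lemma val_neq_m_infty (z : gC) : val z <> m_infty.
Proof.
unfold val; generalize (repr z); clear z; intros z; unfold net_val.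
destruct (Lub_Rbar_correct
  (fun b : R => for_small (fun e => Cmod (z e) <= Rpower e b))) as [Hub _].
intros Heq; rewrite Heq in Hub; destruct (net_moderate z) as [N HN].
apply (Hub (- INR N)); revert HN; apply for_small_imp; intros e.
now rewrite Rpower_Ropp, Rpower_pow by apply eps_range.
Qed.

Lemma sharp_norm_0 : sharp_norm zero = 0.
Proof.
unfold sharp_norm; change (@zero gC_AbelianMonoid) with (gC_const 0).
unfold gC_const; rewrite val_cls; unfold net_val.
destruct (Lub_Rbar_correct (fun b : R => for_small (fun e =>
  Cmod (mnet_const 0 e) <= Rpower e b))) as [Hub _].
destruct Lub_Rbar as [l| |]; auto.
assert (H : Rbar_le (l + 1) l).
{ apply Hub, for_small_all; intros e; simpl; rewrite Cmod_0; apply Rlt_le, exp_pos. }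
simpl in H; lra.
Qed.

Lemma sharp_ball_center (z0 : gC) (r : R) (hr : 0 < r) : sharp_ball z0 r z0.
Proof.
unfold sharp_ball; generalize sharp_norm_0; intros H.
assert (Hm : minus z0 z0 = zero) by apply minus_eq_zero.
now rewrite Hm; change (sharp_norm zero < r); rewrite H.
Qed.

(* [C] is [R * R], which is the identification of the complex numbers with the
   plane.  Both components of a complex-valued function are differentiated. *)
Definition Dx (f : C -> C) (z : C) : C :=
  (Derive (fun t => Re (f (t, Im z))) (Re z), Derive (fun t => Im (f (t, Im z))) (Re z)).

Definition Dy (f : C -> C) (z : C) : C :=
  (Derive (fun t => Re (f (Re z, t))) (Im z), Derive (fun t => Im (f (Re z, t))) (Im z)).

Definition ex_partials (f : C -> C) (z : C) : Prop :=
  ex_derive (fun t => Re (f (t, Im z))) (Re z) /\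
  ex_derive (fun t => Im (f (t, Im z))) (Re z) /\
  ex_derive (fun t => Re (f (Re z, t))) (Im z) /\
  ex_derive (fun t => Im (f (Re z, t))) (Im z).

Fixpoint Ck (n : nat) (f : C -> C) : Prop :=
  (forall z, continuous f z) /\
  match n with
  | O => True
  | S m => (forall z, ex_partials f z) /\ Ck m (Dx f) /\ Ck m (Dy f)
  end.

Definition smooth (f : C -> C) : Prop := forall n, Ck n f.

Definition pder (a b : nat) (f : C -> C) : C -> C := Nat.iter a Dx (Nat.iter b Dy f).

Lemma smooth_continuous f : smooth f -> forall z, continuous f z.
Proof. intros H; apply (H 0%nat). Qed.

Lemma smooth_partials f : smooth f -> forall z, ex_partials f z.
Proof. intros H; apply (H 1%nat). Qed.

Lemma smooth_Dx f : smooth f -> smooth (Dx f).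
Proof. intros H n; apply (H (S n)). Qed.

Lemma smooth_Dy f : smooth f -> smooth (Dy f).
Proof. intros H n; apply (H (S n)). Qed.

Lemma smooth_const (c : C) : smooth (fun _ => c).
Proof.
intros n; revert c; induction n as [|n IH]; intros c; split; auto.
1, 2: intros z; apply continuous_const.
split.
{ intros z; repeat split; apply (ex_derive_const (V := R_NormedModule)). }
assert (Hx : Dx (fun _ => c) = fun _ => (0, 0)).
{ apply functional_extensionality; intros z; unfold Dx; now rewrite !Derive_const. }
assert (Hy : Dy (fun _ => c) = fun _ => (0, 0)).
{ apply functional_extensionality; intros z; unfold Dy; now rewrite !Derive_const. }
rewrite Hx, Hy; auto.
Qed.

Lemma pder_0 a b : pder a b (fun _ => RtoC 0) = fun _ => RtoC 0.
Proof.
assert (Hx : Dx (fun _ => RtoC 0) = fun _ => RtoC 0).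
{ apply functional_extensionality; intros z; unfold Dx; now rewrite !Derive_const. }
assert (Hy : Dy (fun _ => RtoC 0) = fun _ => RtoC 0).
{ apply functional_extensionality; intros z; unfold Dy; now rewrite !Derive_const. }
unfold pder.
induction a as [|a IH]; simpl; [| now rewrite IH].
induction b as [|b IH]; simpl; [reflexivity | now rewrite IH].
Qed.

Definition lin (c : C) (f g : C -> C) (z : C) : C := (c * f z + g z)%C.

Lemma lin_partials c f g z :
  ex_partials f z -> ex_partials g z -> ex_partials (lin c f g) z.
Proof.
intros [H1 [H2 [H3 H4]]] [K1 [K2 [K3 K4]]]; unfold lin; repeat split; simpl.
- apply (ex_derive_plus (V := R_NormedModule)); [apply (ex_derive_minus (V := R_NormedModule));
    apply (ex_derive_scal (fun t => _)) |]; assumption.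
- apply (ex_derive_plus (V := R_NormedModule)); [apply (ex_derive_plus (V := R_NormedModule));
    apply (ex_derive_scal (fun t => _)) |]; assumption.
- apply (ex_derive_plus (V := R_NormedModule)); [apply (ex_derive_minus (V := R_NormedModule));
    apply (ex_derive_scal (fun t => _)) |]; assumption.
- apply (ex_derive_plus (V := R_NormedModule)); [apply (ex_derive_plus (V := R_NormedModule));
    apply (ex_derive_scal (fun t => _)) |]; assumption.
Qed.

Lemma Derive_lin_re (a b : R) (f g h : R -> R) x :
  ex_derive f x -> ex_derive g x -> ex_derive h x ->
  Derive (fun t => a * f t - b * g t + h t) x = a * Derive f x - b * Derive g x + Derive h x.
Proof. intros H1 H2 H3; apply is_derive_unique; auto_derive; [tauto |].
change (fun t => f t) with f; change (fun t => g t) with g; change (fun t => h t) with h; ring.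
Qed.

Lemma Derive_lin_im (a b : R) (f g h : R -> R) x :
  ex_derive f x -> ex_derive g x -> ex_derive h x ->
  Derive (fun t => a * f t + b * g t + h t) x = a * Derive f x + b * Derive g x + Derive h x.
Proof. intros H1 H2 H3; apply is_derive_unique; auto_derive; [tauto |].
change (fun t => f t) with f; change (fun t => g t) with g; change (fun t => h t) with h; ring.
Qed.

Lemma Dx_lin c f g : (forall z, ex_partials f z) -> (forall z, ex_partials g z) ->
  Dx (lin c f g) = lin c (Dx f) (Dx g).
Proof.
intros Hf Hg; apply functional_extensionality; intros z.
destruct (Hf z) as [H1 [H2 _]], (Hg z) as [K1 [K2 _]]; unfold Re, Im in *.
unfold Dx, lin, Cplus, Cmult, Re, Im; simpl; f_equal.
- now apply Derive_lin_re.
- now apply Derive_lin_im.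
Qed.

Lemma Dy_lin c f g : (forall z, ex_partials f z) -> (forall z, ex_partials g z) ->
  Dy (lin c f g) = lin c (Dy f) (Dy g).
Proof.
intros Hf Hg; apply functional_extensionality; intros z.
destruct (Hf z) as [_ [_ [H1 H2]]], (Hg z) as [_ [_ [K1 K2]]]; unfold Re, Im in *.
unfold Dy, lin, Cplus, Cmult, Re, Im; simpl; f_equal.
- now apply Derive_lin_re.
- now apply Derive_lin_im.
Qed.

Lemma continuous_lin c f g z :
  continuous f z -> continuous g z -> continuous (lin c f g) z.
Proof.
intros Hf Hg.
assert (Hre : forall h : C -> C, continuous h z -> continuous (fun w => Re (h w)) z).
{ intros h Hh; apply (continuous_comp h (fun w : C => fst w) z Hh).
  destruct (h z) as [a b]; apply continuous_fst. }
assert (Him : forall h : C -> C, continuous h z -> continuous (fun w => Im (h w)) z).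
{ intros h Hh; apply (continuous_comp h (fun w : C => snd w) z Hh).
  destruct (h z) as [a b]; apply continuous_snd. }
assert (Hsc : forall (a : R) (k : C -> R), continuous k z -> continuous (fun w => a * k w) z).
{ intros a k Hk; apply (continuous_scal_r a k z Hk). }
assert (Hpl : forall (k l : C -> R), continuous k z -> continuous l z ->
  continuous (fun w => k w + l w) z).
{ intros k l Hk Hl; exact (continuous_plus k l z Hk Hl). }
assert (Hmi : forall (k l : C -> R), continuous k z -> continuous l z ->
  continuous (fun w => k w - l w) z).
{ intros k l Hk Hl; exact (continuous_minus k l z Hk Hl). }
apply (continuous_comp_2
  (fun w => Re c * Re (f w) - Im c * Im (f w) + Re (g w))
  (fun w => Re c * Im (f w) + Im c * Re (f w) + Im (g w)) (fun a b : R => (a, b) : C) z).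
- auto 10.
- auto 10.
- apply continuous_ext with (fun w : C => w); [now intros [a b] | apply continuous_id].
Qed.

Lemma smooth_lin c f g : smooth f -> smooth g -> smooth (lin c f g).
Proof.
intros Hf Hg n; revert f g Hf Hg; induction n as [|n IH]; intros f g Hf Hg; split; auto.
1, 2: intros z; apply continuous_lin; now apply smooth_continuous.
split; [| split].
- intros z; apply lin_partials; now apply smooth_partials.
- rewrite Dx_lin by now apply smooth_partials.
  apply IH; now apply smooth_Dx.
- rewrite Dy_lin by now apply smooth_partials.
  apply IH; now apply smooth_Dy.
Qed.

Lemma smooth_iter_Dy b f : smooth f -> smooth (Nat.iter b Dy f).
Proof. intros Hf; induction b; simpl; auto using smooth_Dy. Qed.

Lemma smooth_pder a b f : smooth f -> smooth (pder a b f).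
Proof.
intros Hf; unfold pder; induction a; simpl; auto using smooth_Dx, smooth_iter_Dy.
Qed.

Lemma pder_lin a b c f g : smooth f -> smooth g ->
  pder a b (lin c f g) = lin c (pder a b f) (pder a b g).
Proof.
intros Hf Hg; unfold pder.
assert (Hy : Nat.iter b Dy (lin c f g) = lin c (Nat.iter b Dy f) (Nat.iter b Dy g)).
{ induction b as [|b IH]; simpl; auto; rewrite IH.
  apply Dy_lin; now apply smooth_partials, smooth_iter_Dy. }
rewrite Hy; clear Hy; induction a as [|a IH]; simpl; auto; rewrite IH.
apply Dx_lin; apply smooth_partials; now apply (smooth_pder a b).
Qed.

Lemma continuity_2d_Re f z : (forall z, continuous f z) ->
  continuity_2d_pt (fun u v => Re (f (u, v))) (Re z) (Im z).
Proof.
intros H; apply continuity_2d_pt_filterlim.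
generalize (continuous_comp f (fun w : C => fst w) z (H z)); destruct z as [x y]; intros K.
change (continuous (fun w : R * R => Re (f (fst w, snd w))) (x, y)).
apply (continuous_ext (fun w => fst (f w))); [now intros [a b] |].
apply K; destruct (f (x, y)) as [a b]; apply continuous_fst.
Qed.

Lemma continuity_2d_Im f z : (forall z, continuous f z) ->
  continuity_2d_pt (fun u v => Im (f (u, v))) (Re z) (Im z).
Proof.
intros H; apply continuity_2d_pt_filterlim.
generalize (continuous_comp f (fun w : C => snd w) z (H z)); destruct z as [x y]; intros K.
change (continuous (fun w : R * R => Im (f (fst w, snd w))) (x, y)).
apply (continuous_ext (fun w => snd (f w))); [now intros [a b] |].
apply K; destruct (f (x, y)) as [a b]; apply continuous_snd.
Qed.

Lemma Dx_Dy_comm f : smooth f -> Dx (Dy f) = Dy (Dx f).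
Proof.
intros Hf; apply functional_extensionality; intros z.
assert (Hc1 := smooth_continuous _ (smooth_Dx _ (smooth_Dy _ Hf))).
assert (Hc2 := smooth_continuous _ (smooth_Dy _ (smooth_Dx _ Hf))).
assert (P0 := smooth_partials _ Hf).
assert (P1 := smooth_partials _ (smooth_Dx _ Hf)).
assert (P2 := smooth_partials _ (smooth_Dy _ Hf)).
unfold Dx at 1, Dy at 3; f_equal.
- change (Derive (fun s => Derive (fun t => Re (f (s, t))) (Im z)) (Re z) =
    Derive (fun t => Derive (fun s => Re (f (s, t))) (Re z)) (Im z)).
  apply (Schwarz (fun x y => Re (f (x, y))) (Re z) (Im z)).
  + apply locally_2d_forall; intros x y; repeat split.
    * apply (P0 (x, y)).
    * apply (P0 (x, y)).
    * apply (P2 (x, y)).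
    * apply (P1 (x, y)).
  + apply (continuity_2d_Re (Dx (Dy f)) z Hc1).
  + apply (continuity_2d_Re (Dy (Dx f)) z Hc2).
- change (Derive (fun s => Derive (fun t => Im (f (s, t))) (Im z)) (Re z) =
    Derive (fun t => Derive (fun s => Im (f (s, t))) (Re z)) (Im z)).
  apply (Schwarz (fun x y => Im (f (x, y))) (Re z) (Im z)).
  + apply locally_2d_forall; intros x y; repeat split.
    * apply (P0 (x, y)).
    * apply (P0 (x, y)).
    * apply (P2 (x, y)).
    * apply (P1 (x, y)).
  + apply (continuity_2d_Im (Dx (Dy f)) z Hc1).
  + apply (continuity_2d_Im (Dy (Dx f)) z Hc2).
Qed.

Lemma pder_Dx a b f : smooth f -> pder a b (Dx f) = pder (S a) b f.
Proof.
intros Hf; unfold pder.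
assert (H : Nat.iter b Dy (Dx f) = Dx (Nat.iter b Dy f)).
{ induction b as [|b IH]; simpl; auto; rewrite IH.
  symmetry; now apply Dx_Dy_comm, smooth_iter_Dy. }
rewrite H; now rewrite <- Nat.iter_succ_r.
Qed.

Lemma pder_Dy a b f : pder a b (Dy f) = pder a (S b) f.
Proof. unfold pder; now rewrite Nat.iter_succ_r. Qed.

Definition in_EM (A : gC -> Prop) (u : index -> C -> C) : Prop :=
  (forall e, smooth (u e)) /\
  forall (a b : nat) (x : mnet), A (cls x) -> moderate (fun e => pder a b (u e) (x e)).

Definition in_N (A : gC -> Prop) (u : index -> C -> C) : Prop :=
  (forall e, smooth (u e)) /\
  forall (a b : nat) (x : mnet), A (cls x) -> negligible (fun e => pder a b (u e) (x e)).

Lemma in_EM_lin A c u v : in_EM A u -> in_EM A v -> in_EM A (fun e => lin c (u e) (v e)).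
Proof.
intros [H1 H2] [K1 K2]; split; [intros e; now apply smooth_lin |].
intros a b x Hx.
replace (fun e => pder a b (lin c (u e) (v e)) (x e)) with
  (fun e => (fun _ => c) e * pder a b (u e) (x e) + pder a b (v e) (x e))%C.
- apply moderate_plus; auto; apply moderate_mult; auto using moderate_const.
- apply functional_extensionality; intros e; now rewrite pder_lin.
Qed.

Lemma in_N_lin A c u v : in_N A u -> in_N A v -> in_N A (fun e => lin c (u e) (v e)).
Proof.
intros [H1 H2] [K1 K2]; split; [intros e; now apply smooth_lin |].
intros a b x Hx.
replace (fun e => pder a b (lin c (u e) (v e)) (x e)) with
  (fun e => (fun _ => c) e * pder a b (u e) (x e) + pder a b (v e) (x e))%C.
- apply negligible_plus; auto; apply negligible_mult; auto using moderate_const.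
- apply functional_extensionality; intros e; now rewrite pder_lin.
Qed.

Lemma in_N_0 A : in_N A (fun _ _ => RtoC 0).
Proof.
split; [intros _; apply smooth_const |]; intros a b x _.
rewrite pder_0; apply negligible_0.
Qed.

Lemma in_N_EM A u : in_N A u -> in_EM A u.
Proof. intros [H1 H2]; split; auto using negligible_moderate. Qed.

Lemma in_N_ext A u v : (forall e z, u e z = v e z) -> in_N A u -> in_N A v.
Proof.
intros H; replace v with u; auto.
now apply functional_extensionality; intros e; apply functional_extensionality.
Qed.

Lemma in_EM_ext A u v : (forall e z, u e z = v e z) -> in_EM A u -> in_EM A v.
Proof.
intros H; replace v with u; auto.
now apply functional_extensionality; intros e; apply functional_extensionality.
Qed.

Lemma in_EM_Dx A u : in_EM A u -> in_EM A (fun e => Dx (u e)).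
Proof.
intros [H1 H2]; split; [intros e; now apply smooth_Dx |].
intros a b x Hx; generalize (H2 (S a) b x Hx).
now replace (fun e => pder a b (Dx (u e)) (x e)) with (fun e => pder (S a) b (u e) (x e))
  by (apply functional_extensionality; intros e; now rewrite pder_Dx).
Qed.

Lemma in_N_Dx A u : in_N A u -> in_N A (fun e => Dx (u e)).
Proof.
intros [H1 H2]; split; [intros e; now apply smooth_Dx |].
intros a b x Hx; generalize (H2 (S a) b x Hx).
now replace (fun e => pder a b (Dx (u e)) (x e)) with (fun e => pder (S a) b (u e) (x e))
  by (apply functional_extensionality; intros e; now rewrite pder_Dx).
Qed.

Lemma in_EM_Dy A u : in_EM A u -> in_EM A (fun e => Dy (u e)).
Proof.
intros [H1 H2]; split; [intros e; now apply smooth_Dy |].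
intros a b x Hx; generalize (H2 a (S b) x Hx).
now replace (fun e => pder a b (Dy (u e)) (x e)) with (fun e => pder a (S b) (u e) (x e))
  by (apply functional_extensionality; intros e; now rewrite pder_Dy).
Qed.

Lemma in_N_Dy A u : in_N A u -> in_N A (fun e => Dy (u e)).
Proof.
intros [H1 H2]; split; [intros e; now apply smooth_Dy |].
intros a b x Hx; generalize (H2 a (S b) x Hx).
now replace (fun e => pder a b (Dy (u e)) (x e)) with (fun e => pder a (S b) (u e) (x e))
  by (apply functional_extensionality; intros e; now rewrite pder_Dy).
Qed.

Record fnet (A : gC -> Prop) : Type :=
  FNet { fn :> index -> C -> C; fn_EM : in_EM A fn }.
Arguments FNet {A}.
Arguments fn {A}.
Arguments fn_EM {A}.

Definition fnet_equiv (A : gC -> Prop) (u v : fnet A) : Prop :=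
  in_N A (fun e z => u e z - v e z)%C.

Lemma fnet_equiv_is_equiv A : is_equiv (fnet_equiv A).
Proof.
unfold fnet_equiv; split; [| split].
- intros u; apply in_N_ext with (2 := in_N_0 A); intros e z; ring.
- intros u v H; generalize (in_N_lin A (- (1))%C _ _ H (in_N_0 A)).
  apply in_N_ext; intros e z; unfold lin; ring.
- intros u v w H K; generalize (in_N_lin A 1%C _ _ H K).
  apply in_N_ext; intros e z; unfold lin; ring.
Qed.

Definition gF (A : gC -> Prop) : Type := quot (fnet_equiv A).

Lemma in_EM_0 A : in_EM A (fun _ _ => RtoC 0).
Proof. apply in_N_EM, in_N_0. Qed.

Lemma in_EM_plus A u v : in_EM A u -> in_EM A v -> in_EM A (fun e z => u e z + v e z)%C.
Proof.
intros Hu Hv; generalize (in_EM_lin A 1%C u v Hu Hv).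
apply in_EM_ext; intros e z; unfold lin; ring.
Qed.

Lemma in_EM_scal A c u : in_EM A u -> in_EM A (fun e z => c * u e z)%C.
Proof.
intros Hu; generalize (in_EM_lin A c u _ Hu (in_EM_0 A)).
apply in_EM_ext; intros e z; unfold lin; ring.
Qed.

Definition fnet_0 A : fnet A := FNet _ (in_EM_0 A).
Definition fnet_plus {A} (u v : fnet A) : fnet A :=
  FNet _ (in_EM_plus A u v (fn_EM u) (fn_EM v)).
Definition fnet_scal {A} (c : C) (u : fnet A) : fnet A :=
  FNet _ (in_EM_scal A c u (fn_EM u)).
Definition fnet_Dx {A} (u : fnet A) : fnet A := FNet _ (in_EM_Dx A u (fn_EM u)).
Definition fnet_Dy {A} (u : fnet A) : fnet A := FNet _ (in_EM_Dy A u (fn_EM u)).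

Definition gF_0 (A : gC -> Prop) : gF A := cls (fnet_0 A).
Definition gF_plus {A} (u v : gF A) : gF A := cls (fnet_plus (repr u) (repr v)).
Definition gF_scal {A} (c : C) (u : gF A) : gF A := cls (fnet_scal c (repr u)).
Definition gF_Dx {A} (u : gF A) : gF A := cls (fnet_Dx (repr u)).
Definition gF_Dy {A} (u : gF A) : gF A := cls (fnet_Dy (repr u)).

Lemma gF_plus_cls {A} (u v : fnet A) : gF_plus (cls u) (cls v) = cls (fnet_plus u v).
Proof.
apply (cls_eq (fnet_equiv_is_equiv A)).
generalize (in_N_lin A 1%C _ _ (repr_cls (fnet_equiv_is_equiv A) u)
  (repr_cls (fnet_equiv_is_equiv A) v)).
apply in_N_ext; intros e z; unfold lin; simpl; ring.
Qed.

Lemma gF_scal_cls {A} c (u : fnet A) : gF_scal c (cls u) = cls (fnet_scal c u).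
Proof.
apply (cls_eq (fnet_equiv_is_equiv A)).
generalize (in_N_lin A c _ _ (repr_cls (fnet_equiv_is_equiv A) u) (in_N_0 A)).
apply in_N_ext; intros e z; unfold lin; simpl; ring.
Qed.

Lemma fnet_smooth {A} (u : fnet A) e : smooth (u e).
Proof. apply (fn_EM u). Qed.

Lemma gF_Dx_cls {A} (u : fnet A) : gF_Dx (cls u) = cls (fnet_Dx u).
Proof.
apply (cls_eq (fnet_equiv_is_equiv A)).
generalize (in_N_Dx A _ (repr_cls (fnet_equiv_is_equiv A) u)).
apply in_N_ext; intros e z; simpl.
set (v := repr (cls u)).
replace (fun z => v e z - u e z)%C with (lin (- (1))%C (u e) (v e))
  by (apply functional_extensionality; intros w; unfold lin; ring).
rewrite Dx_lin by apply smooth_partials, fnet_smooth; unfold lin; ring.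
Qed.

Lemma gF_Dy_cls {A} (u : fnet A) : gF_Dy (cls u) = cls (fnet_Dy u).
Proof.
apply (cls_eq (fnet_equiv_is_equiv A)).
generalize (in_N_Dy A _ (repr_cls (fnet_equiv_is_equiv A) u)).
apply in_N_ext; intros e z; simpl.
set (v := repr (cls u)).
replace (fun z => v e z - u e z)%C with (lin (- (1))%C (u e) (v e))
  by (apply functional_extensionality; intros w; unfold lin; ring).
rewrite Dy_lin by apply smooth_partials, fnet_smooth; unfold lin; ring.
Qed.

Definition dbar {A} (u : gF A) : gF A :=
  gF_scal (/ 2)%C (gF_plus (gF_Dx u) (gF_scal Ci (gF_Dy u))).

Definition holomorphic {A} (u : gF A) : Prop := dbar u = gF_0 A.

(* On a holomorphic [u], [gF_Dx u] is the complex derivative of [u]. *)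
Definition Dk {A} (k : nat) (u : gF A) : gF A := Nat.iter k gF_Dx u.

Lemma fnet_eval_moderate {A} (u : fnet A) (x : mnet) :
  A (cls x) -> moderate (fun e => u e (x e)).
Proof. intros Hx; exact (proj2 (fn_EM u) 0%nat 0%nat x Hx). Qed.

Definition fnet_eval {A} (u : fnet A) (x : mnet) (hx : A (cls x)) : mnet :=
  MNet _ (fnet_eval_moderate u x hx).

(* Independent of the representatives, see [gF_eval_cls]. *)
Definition gF_eval {A : gC -> Prop} (u : gF A) (x : gC) (hx : A x) : gC :=
  cls (fnet_eval (repr u) (repr x) (eq_ind_r A hx (cls_repr x))).

Lemma MVT_abs (f : R -> R) (a b : R) : (forall t, ex_derive f t) ->
  exists c, Rabs (a - c) <= Rabs (a - b) /\ f a - f b = Derive f c * (a - b).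
Proof.
intros H; destruct (MVT_gen f b a (Derive f)) as [c [Hc Heq]].
- intros x _; now apply Derive_correct.
- intros x _; apply continuity_pt_filterlim; exact (ex_derive_continuous f x (H x)).
- exists c; split; [| exact Heq]; revert Hc; unfold Rmin, Rmax.
  destruct (Rle_dec b a); intros Hc; unfold Rabs; repeat destruct Rcase_abs; lra.
Qed.

Lemma negligible_perturb (x : mnet) (y : index -> C) :
  negligible (fun e => x e - y e)%C -> exists y' : mnet, net y' = y /\ cls y' = cls x :> gC.
Proof.
intros H; assert (Hy : moderate y).
{ generalize (moderate_plus _ _ (net_moderate x) (moderate_mult _ _ (moderate_const (- (1))%C)
    (negligible_moderate _ H))).
  now replace (fun e => x e + - (1) * (x e - y e))%C with y
    by (apply functional_extensionality; intros e; ring). }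
exists (MNet y Hy); split; auto; apply (cls_eq net_equiv_is_equiv).
now apply net_equiv_is_equiv.
Qed.

Lemma Cmod_le_parts (a b c d : R) :
  Rabs a <= Rabs c -> Rabs b <= Rabs d -> Cmod (a, b) <= Cmod (c, d).
Proof.
intros H1 H2; unfold Cmod; simpl; apply sqrt_le_1_alt.
generalize (Rsqr_le_abs_1 a c H1) (Rsqr_le_abs_1 b d H2); unfold Rsqr; lra.
Qed.

Lemma MVT_2d (g : R -> R -> R) (z w : C) :
  (forall v t, ex_derive (fun s => g s v) t) -> (forall v t, ex_derive (g v) t) ->
  exists p : C * C, Cmod (z - fst p)%C <= Cmod (z - w)%C /\ Cmod (z - snd p)%C <= Cmod (z - w)%C /\
    g (Re z) (Im z) - g (Re w) (Im w) =
    Derive (fun s => g s (Im (fst p))) (Re (fst p)) * Re (z - w)%C +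
    Derive (g (Re (snd p))) (Im (snd p)) * Im (z - w)%C.
Proof.
intros Hx Hy; destruct z as [z1 z2], w as [w1 w2].
destruct (MVT_abs (fun s => g s z2) z1 w1 (Hx z2)) as [c [Hc Ec]].
destruct (MVT_abs (g w1) z2 w2 (Hy w1)) as [d [Hd Ed]].
exists ((c, z2), (w1, d)); simpl in *; split; [| split].
- apply Cmod_le_parts; [exact Hc |].
  unfold Re, Im; simpl; rewrite Rplus_opp_r, Rabs_R0; apply Rabs_pos.
- apply Cmod_le_parts; [apply Rle_refl | exact Hd].
- unfold Rminus in *; lra.
Qed.

Lemma negligible_parts (z : index -> C) :
  negligible (fun e => RtoC (Re (z e))) -> negligible (fun e => RtoC (Im (z e))) -> negligible z.
Proof.
intros H1 H2; generalize (negligible_plus _ _ H1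
  (negligible_mult _ _ (moderate_const Ci) H2)).
apply negligible_ext; intros e; destruct (z e) as [a b].
unfold Cplus, Cmult, Ci, RtoC, Re, Im; simpl; f_equal; ring.
Qed.

Lemma eval_aux {A} (u : fnet A) (x y : mnet) (g : index -> R -> R -> R) :
  A (cls x) -> net_equiv x y ->
  (forall e v t, ex_derive (fun s => g e s v) t) -> (forall e v t, ex_derive (g e v) t) ->
  (forall e z, Rabs (Derive (fun s => g e s (Im z)) (Re z)) <= Cmod (Dx (u e) z)) ->
  (forall e z, Rabs (Derive (g e (Re z)) (Im z)) <= Cmod (Dy (u e) z)) ->
  negligible (fun e => RtoC (g e (Re (x e)) (Im (x e)) - g e (Re (y e)) (Im (y e)))).
Proof.
intros Hx Hxy Hd1 Hd2 Hb1 Hb2.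
set (p := fun e => proj1_sig (constructive_indefinite_description _
  (MVT_2d (g e) (x e) (y e) (Hd1 e) (Hd2 e)))).
assert (Hp : forall e, Cmod (x e - fst (p e))%C <= Cmod (x e - y e)%C /\
  Cmod (x e - snd (p e))%C <= Cmod (x e - y e)%C /\
  g e (Re (x e)) (Im (x e)) - g e (Re (y e)) (Im (y e)) =
    Derive (fun s => g e s (Im (fst (p e)))) (Re (fst (p e))) * Re (x e - y e)%C +
    Derive (g e (Re (snd (p e)))) (Im (snd (p e))) * Im (x e - y e)%C).
{ intros e; unfold p; destruct constructive_indefinite_description; assumption. }
clearbody p.
assert (H1 : negligible (fun e => x e - fst (p e))%C).
{ apply negligible_le with (2 := Hxy); intros e; apply Hp. }
assert (H2 : negligible (fun e => x e - snd (p e))%C).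
{ apply negligible_le with (2 := Hxy); intros e; apply Hp. }
destruct (negligible_perturb x _ H1) as [c [Hc Ec]].
destruct (negligible_perturb x _ H2) as [d [Hd Ed]].
rewrite <- Ec in Hx; assert (K1 := proj2 (fn_EM u) 1%nat 0%nat c Hx).
rewrite Ec, <- Ed in Hx; assert (K2 := proj2 (fn_EM u) 0%nat 1%nat d Hx).
simpl in K1, K2; rewrite Hc in K1; rewrite Hd in K2; unfold pder in K1, K2; simpl in K1, K2.
apply negligible_ext with (z := fun e =>
  (RtoC (Derive (fun s => g e s (Im (fst (p e)))) (Re (fst (p e))) * Re (x e - y e)%C) +
   RtoC (Derive (g e (Re (snd (p e)))) (Im (snd (p e))) * Im (x e - y e)%C))%C).
{ intros e; rewrite <- RtoC_plus; f_equal; symmetry; apply Hp. }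
apply negligible_plus.
- apply negligible_le with (2 := negligible_mult _ _ K1 Hxy); intros e.
  rewrite Cmod_R, Rabs_mult, Cmod_mult; apply Rmult_le_compat; auto using Rabs_pos.
  apply re_le_Cmod.
- apply negligible_le with (2 := negligible_mult _ _ K2 Hxy); intros e.
  rewrite Cmod_R, Rabs_mult, Cmod_mult; apply Rmult_le_compat; auto using Rabs_pos.
  apply Rle_trans with (2 := Rmax_Cmod _), Rmax_r.
Qed.

Lemma fnet_eval_equiv {A} (u : fnet A) (x y : mnet) : A (cls x) -> net_equiv x y ->
  negligible (fun e => u e (x e) - u e (y e))%C.
Proof.
intros Hx Hxy; apply negligible_parts.
- generalize (eval_aux u x y (fun e s t => Re (u e (s, t))) Hx Hxy); intros H.
  apply negligible_ext with (2 := H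
    (fun e v t => proj1 (smooth_partials _ (fnet_smooth u e) (t, v)))
    (fun e v t => proj1 (proj2 (proj2 (smooth_partials _ (fnet_smooth u e) (v, t)))))
    (fun e z => Rle_trans _ _ _ (Rmax_l _ _) (Rmax_Cmod (Dx (u e) z)))
    (fun e z => Rle_trans _ _ _ (Rmax_l _ _) (Rmax_Cmod (Dy (u e) z)))).
  intros e; destruct (x e), (y e); reflexivity.
- generalize (eval_aux u x y (fun e s t => Im (u e (s, t))) Hx Hxy); intros H.
  apply negligible_ext with (2 := H
    (fun e v t => proj1 (proj2 (smooth_partials _ (fnet_smooth u e) (t, v))))
    (fun e v t => proj2 (proj2 (proj2 (smooth_partials _ (fnet_smooth u e) (v, t)))))
    (fun e z => Rle_trans _ _ _ (Rmax_r _ _) (Rmax_Cmod (Dx (u e) z)))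
    (fun e z => Rle_trans _ _ _ (Rmax_r _ _) (Rmax_Cmod (Dy (u e) z)))).
  intros e; destruct (x e), (y e); reflexivity.
Qed.

Lemma gF_eval_cls {A : gC -> Prop} (u : fnet A) (x : mnet) (hx : A (cls x)) :
  gF_eval (cls u) (cls x) hx = cls (fnet_eval u x hx).
Proof.
apply (cls_eq net_equiv_is_equiv); unfold net_equiv; simpl.
set (v := repr (cls u)); set (y := repr (cls x)).
assert (Hu : fnet_equiv A v u) by apply (repr_cls (fnet_equiv_is_equiv A)).
assert (Hy : net_equiv y x) by apply (repr_cls net_equiv_is_equiv).
assert (HAy : A (cls y)) by (unfold y; now rewrite cls_repr).
generalize (negligible_plus _ _ (proj2 Hu 0%nat 0%nat y HAy) (fnet_eval_equiv u y x HAy Hy)).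
apply negligible_ext; intros e; unfold pder; simpl; ring.
Qed.

Definition zeroes {A : gC -> Prop} (u : gF A) (z : gC) : Prop :=
  exists hz : A z, gF_eval u z hz = zero.

Definition strict_accumulation_point (S : gC -> Prop) (z0 : gC) : Prop :=
  forall r : R, 0 < r ->
  exists z : gC, S z /\ invertible (minus z z0) /\ sharp_norm (minus z z0) < r.

(* Main.v *)
Require Import Defs.
From Stdlib Require Import Reals.
From Coquelicot Require Import Coquelicot.
From Stdlib Require Import Wf_nat Lra Lia Classical ClassicalEpsilon FunctionalExtensionality.
(* [Reals] and [Defs] both define [Dx]. *)
Import Defs.
Open Scope R_scope.

(* A representative of [u] is holomorphic only up to a negligible error, so Cauchy's integral
   formula is replaced by a gradient estimate obtained from the maximum principle: if [|f| <= M]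
   and [|laplacian f| <= h] on a square of half side [d], then [|Dx f| <= 4 M / d + h d] at its
   centre.  Iterating it gives Cauchy estimates for all derivatives with a negligible error.

   If the jet of [u] at [z0] vanishes, these estimates on a disc of radius [eps^b'] and Taylor's
   formula of order [K] bound [u] on the disc of radius [eps^b], where [b' < b], by
   [(C eps^(b - b'))^K eps^(- N)] up to a negligible term, with [N] independent of [K].

   If the derivatives of order less than [k] vanish at [z0] and [u] vanishes at a point [z] with
   [z - z0] invertible, Taylor's formula divided by [(z - z0)^k] bounds [D^k u(z0)] by a fixed
   moderate multiple of [|z - z0|] up to a negligible term, and [z] can be taken as close to [z0]
   as desired. *)

(** * The maximum principle and a gradient estimate *)

Lemma continuity_2d_pt_slice_r g x y : continuity_2d_pt g x y -> continuity_pt (g x) y.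
Proof.
intros H; apply continuity_pt_filterlim; intros P [e He].
destruct (H e) as [d Hd]; exists d; intros v Hv; apply He.
apply Hd; [rewrite Rminus_diag, Rabs_R0; apply cond_pos | exact Hv].
Qed.

(** First maximise over [y] for each fixed [x]. By uniform continuity on a strip, the resulting
    partial maximum is a continuous function of [x], so it attains its own maximum on [[a, b]]. *)
Lemma rectangle_max (g : R -> R -> R) (a b c d : R) : a <= b -> c <= d ->
  (forall x y, continuity_2d_pt g x y) ->
  exists X Y, a <= X <= b /\ c <= Y <= d /\
    forall x y, a <= x <= b -> c <= y <= d -> g x y <= g X Y.
Proof.
intros Hab Hcd Hg.
assert (Hs : forall x, exists Y, (forall y, c <= y <= d -> g x y <= g x Y) /\ c <= Y <= d).
{ intros x; apply continuity_ab_maj; auto; intros y _; now apply continuity_2d_pt_slice_r. }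
set (Y := fun x => proj1_sig (constructive_indefinite_description _ (Hs x))).
assert (HY : forall x, (forall y, c <= y <= d -> g x y <= g x (Y x)) /\ c <= Y x <= d).
{ intros x; unfold Y; destruct constructive_indefinite_description; assumption. }
clearbody Y.
destruct (continuity_ab_maj (fun x => g x (Y x)) a b Hab) as [X [HX HXab]].
- intros x _; apply continuity_pt_filterlim; intros P [e He].
  destruct (uniform_continuity_2d g (x - 1) (x + 1) c d (fun x y _ _ => Hg x y) e) as [r Hr].
  (* The bound by 1 keeps [t] in the strip on which the modulus [r] was obtained. *)
  assert (Hm : 0 < Rmin r 1) by (apply Rmin_pos; [apply cond_pos | lra]).
  exists (mkposreal _ Hm); intros t Ht; apply He.
  assert (Ht1 : Rabs (t - x) < Rmin r 1) by exact Ht.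
  assert (Ht2 : Rabs (t - x) < r) by (apply Rlt_le_trans with (1 := Ht1), Rmin_l).
  assert (Ht3 : Rabs (t - x) < 1) by (apply Rlt_le_trans with (1 := Ht1), Rmin_r).
  apply Rabs_lt_between in Ht3.
  change (Rabs (g t (Y t) - g x (Y x)) < e).
  assert (K : forall y, c <= y <= d -> Rabs (g t y - g x y) < e).
  { intros y Hy; apply Hr; auto; try lra.
    rewrite Rminus_diag, Rabs_R0; apply cond_pos. }
  destruct (HY t) as [T1 T2], (HY x) as [X1 X2].
  generalize (K (Y t) T2) (K (Y x) X2) (T1 (Y x) X2) (X1 (Y t) T2).
  intros K1 K2; apply Rabs_lt_between in K1; apply Rabs_lt_between in K2.
  intros K3 K4; apply Rabs_lt_between; lra.
- exists X, (Y X); destruct (HY X) as [_ H2]; repeat split; try tauto.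
  intros x y Hx Hy; apply Rle_trans with (g x (Y x)); [now apply HY | now apply HX].
Qed.

(** At the maximum [h'] vanishes. If [l] were positive, [h'] would be positive just to the right of
    [x], and the mean value theorem would give a larger value of [h] there. *)
Lemma second_derivative_le_0_at_max (h h' : R -> R) (x l d : R) : 0 < d ->
  (forall s, is_derive h s (h' s)) -> is_derive h' x l ->
  (forall s, Rabs (s - x) < d -> h s <= h x) -> l <= 0.
Proof.
intros Hd Hh Hl Hmax; apply Rnot_lt_le; intros Hpos.
assert (H0 : h' x = 0).
{ assert (D : derivable_pt h x).
  { exists (h' x); apply is_derive_Reals, Hh. }
  rewrite <- (is_derive_unique h x (h' x) (Hh x)), <- (Derive_Reals h x D).
  apply (deriv_maximum h (x - d) (x + d) x D); try lra.
  intros s Hs1 Hs2; apply Hmax, Rabs_lt_between; lra. }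
assert (Hl' := proj1 (is_derive_Reals h' x l) Hl).
destruct (Hl' (l / 2)) as [r Hr]; [lra |].
assert (Hm : 0 < Rmin r d) by (apply Rmin_pos; [apply cond_pos | lra]).
generalize (Rmin_l r d) (Rmin_r r d); intros M1 M2.
set (k := Rmin r d / 2) in *.
assert (Hk0 : 0 < k) by (unfold k; lra).
destruct (MVT_cor2 h h' x (x + k)) as [s [E Hs]]; [lra | |].
{ intros t _; apply is_derive_Reals, Hh. }
assert (Hk : h (x + k) <= h x).
{ apply Hmax; replace (x + k - x) with k by ring; rewrite Rabs_pos_eq; unfold k in *; lra. }
assert (Hs0 : h' s <= 0) by (apply Rnot_lt_le; intros Hc; nra).
specialize (Hr (s - x) ltac:(lra)).
rewrite Rabs_pos_eq in Hr by lra; specialize (Hr ltac:(unfold k in *; lra)).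
replace (x + (s - x)) with s in Hr by ring; rewrite H0 in Hr.
apply Rabs_lt_between in Hr.
assert (0 < (h' s - 0) / (s - x)) by lra.
assert ((h' s - 0) = (h' s - 0) / (s - x) * (s - x)) by (field; lra).
nra.
Qed.

(** At an interior maximum both pure second derivatives are at most 0, which contradicts the strict
    sign of the Laplacian. Hence the maximum lies on the boundary. *)
Lemma max_principle (g gx gy gxx gyy : R -> R -> R) (a b c d : R) : a <= b -> c <= d ->
  (forall x y, continuity_2d_pt g x y) ->
  (forall x y, is_derive (fun s => g s y) x (gx x y)) ->
  (forall x y, is_derive (fun s => gx s y) x (gxx x y)) ->
  (forall x y, is_derive (g x) y (gy x y)) ->
  (forall x y, is_derive (gy x) y (gyy x y)) ->
  (forall x y, a < x < b -> c < y < d -> 0 < gxx x y + gyy x y) ->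
  (forall x y, a <= x <= b -> c <= y <= d -> x = a \/ x = b \/ y = c \/ y = d -> g x y <= 0) ->
  forall x y, a <= x <= b -> c <= y <= d -> g x y <= 0.
Proof.
intros Hab Hcd Hg Hx Hxx Hy Hyy Hlap Hbd x y Hx0 Hy0.
destruct (rectangle_max g a b c d Hab Hcd Hg) as [X [Y [HX [HY Hmax]]]].
apply Rle_trans with (g X Y); [now apply Hmax |].
destruct (classic (X = a \/ X = b \/ Y = c \/ Y = d)) as [H|H]; [now apply Hbd |].
assert (HXi : a < X < b) by (split; apply Rnot_le_lt; intros H'; apply H; lra).
assert (HYi : c < Y < d) by (split; apply Rnot_le_lt; intros H'; apply H; lra).
exfalso; specialize (Hlap X Y HXi HYi).
assert (K1 : gxx X Y <= 0).
{ apply (second_derivative_le_0_at_max (fun s => g s Y) (fun s => gx s Y) X _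
    (Rmin (X - a) (b - X))); auto.
  - apply Rmin_pos; lra.
  - intros s Hs; generalize (Rmin_l (X - a) (b - X)) (Rmin_r (X - a) (b - X)).
    apply Rabs_lt_between in Hs; intros; apply Hmax; lra. }
assert (K2 : gyy X Y <= 0).
{ apply (second_derivative_le_0_at_max (g X) (gy X) Y _
    (Rmin (Y - c) (d - Y))); auto.
  - apply Rmin_pos; lra.
  - intros s Hs; generalize (Rmin_l (Y - c) (d - Y)) (Rmin_r (Y - c) (d - Y)).
    apply Rabs_lt_between in Hs; intros; apply Hmax; lra. }
lra.
Qed.

Lemma is_derive_shift (F : R -> R) (a x l : R) :
  is_derive F (a + x) l -> is_derive (fun s => F (a + s)) x l.
Proof.
intros H; assert (Hd : is_derive (fun s => a + s) x 1) by (auto_derive; auto; ring).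
generalize (is_derive_comp F (fun s => a + s) x l 1 H Hd).
unfold scal; simpl; unfold mult; simpl; now rewrite Rmult_1_l.
Qed.

Lemma is_derive_reflect (F : R -> R) (a x l : R) :
  is_derive F (a - x) l -> is_derive (fun s => F (a - s)) x (- l).
Proof.
intros H; assert (Hd : is_derive (fun s => a - s) x (- 1)) by (auto_derive; auto; ring).
generalize (is_derive_comp F (fun s => a - s) x l (- 1) H Hd).
unfold scal; simpl; unfold mult; simpl; now replace (- 1 * l) with (- l) by ring.
Qed.

Lemma is_derive_half_diff (A B P : R -> R) (x a b p l : R) :
  is_derive A x a -> is_derive B x b -> is_derive P x p -> l = (a - b) / 2 - p ->
  is_derive (fun s => (A s - B s) / 2 - P s) x l.
Proof.
intros HA HB HP ->; auto_derive.
- repeat split; eexists; eassumption.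
- change (fun s => A s) with A; change (fun s => B s) with B; change (fun s => P s) with P.
  rewrite (is_derive_unique _ _ _ HA), (is_derive_unique _ _ _ HB), (is_derive_unique _ _ _ HP).
  field.
Qed.

Lemma continuity_2d_pt_isometry (V : R -> R -> R) (f g : R -> R) (x y : R) :
  (forall s, Rabs (f s - f x) = Rabs (s - x)) -> (forall s, Rabs (g s - g y) = Rabs (s - y)) ->
  continuity_2d_pt V (f x) (g y) -> continuity_2d_pt (fun u v => V (f u) (g v)) x y.
Proof.
intros Hf Hg H e; destruct (H e) as [r Hr]; exists r; intros u v Hu Hv.
apply Hr; [now rewrite Hf | now rewrite Hg].
Qed.

Lemma derive_le_0_at_left_max (F : R -> R) (x l d : R) : 0 < d -> is_derive F x l ->
  (forall s, x <= s <= x + d -> F s <= F x) -> l <= 0.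
Proof.
intros Hd Hl Hmax; apply Rnot_lt_le; intros Hpos.
destruct (proj1 (is_derive_Reals F x l) Hl l Hpos) as [r Hr].
assert (Hm : 0 < Rmin r d) by (apply Rmin_pos; [apply cond_pos | lra]).
generalize (Rmin_l r d) (Rmin_r r d); intros M1 M2.
set (k := Rmin r d / 2) in *; assert (Hk : 0 < k < Rmin r d) by (unfold k; lra).
specialize (Hr k ltac:(lra)); rewrite Rabs_pos_eq in Hr by lra.
specialize (Hr ltac:(lra)); apply Rabs_lt_between in Hr.
assert (H : F (x + k) <= F x) by (apply Hmax; lra).
assert (0 < (F (x + k) - F x) / k) by lra.
assert (F (x + k) - F x = (F (x + k) - F x) / k * k) by (field; lra).
nra.
Qed.

(* Comparison with a barrier on half of the square, where the function is first made odd in [x]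
   (Gilbarg-Trudinger, (3.16)). *)
Lemma partial_x_le (V Vx Vy Vxx Vyy : R -> R -> R) (x0 y0 d M h : R) : 0 < d ->
  (forall x y, continuity_2d_pt V x y) ->
  (forall x y, is_derive (fun s => V s y) x (Vx x y)) ->
  (forall x y, is_derive (fun s => Vx s y) x (Vxx x y)) ->
  (forall x y, is_derive (V x) y (Vy x y)) ->
  (forall x y, is_derive (Vy x) y (Vyy x y)) ->
  (forall x y, Rabs (x - x0) <= d -> Rabs (y - y0) <= d -> Rabs (V x y) <= M) ->
  (forall x y, Rabs (x - x0) <= d -> Rabs (y - y0) <= d -> Rabs (Vxx x y + Vyy x y) < h) ->
  Vx x0 y0 <= 2 * M / d + h * d / 2.
Proof.
intros Hd Hc Hx Hxx Hy Hyy HM Hh.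
(* The barrier has two parts. The polynomial [y * y + x * (2 * d - x)] is harmonic, and [k] scales
   it to be at least [M] on the three sides other than [x = 0]. The term [h / 2 * (x * (d - x))] has
   Laplacian [- h], so subtracting it makes the Laplacian of [g] positive. *)
set (k := M / (d * d)).
set (g := fun x y => (V (x0 + x) (y0 + y) - V (x0 - x) (y0 + y)) / 2
  - k * (y * y + x * (2 * d - x)) - h / 2 * (x * (d - x))).
assert (Hg : forall x y, 0 <= x <= d -> - d <= y <= d -> g x y <= 0).
{ apply (max_principle g
    (fun x y => (Vx (x0 + x) (y0 + y) + Vx (x0 - x) (y0 + y)) / 2
       - k * (2 * d - 2 * x) - h / 2 * (d - 2 * x))
    (fun x y => (Vy (x0 + x) (y0 + y) - Vy (x0 - x) (y0 + y)) / 2 - k * (2 * y))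
    (fun x y => (Vxx (x0 + x) (y0 + y) - Vxx (x0 - x) (y0 + y)) / 2 + 2 * k + h)
    (fun x y => (Vyy (x0 + x) (y0 + y) - Vyy (x0 - x) (y0 + y)) / 2 - 2 * k)); try lra.
  - intros x y; unfold g; apply continuity_2d_pt_minus; [apply continuity_2d_pt_minus |].
    2, 3: repeat first [apply continuity_2d_pt_mult | apply continuity_2d_pt_plus
      | apply continuity_2d_pt_minus | apply continuity_2d_pt_opp | apply continuity_2d_pt_const
      | apply continuity_2d_pt_id1 | apply continuity_2d_pt_id2].
    apply continuity_2d_pt_mult; [apply continuity_2d_pt_minus | apply continuity_2d_pt_const].
    + apply (continuity_2d_pt_isometry V (fun s => x0 + s) (fun s => y0 + s)); auto;
        intros s; f_equal; ring.
    + apply (continuity_2d_pt_isometry V (fun s => x0 - s) (fun s => y0 + s)); auto;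
        intros s; [rewrite <- Rabs_Ropp |]; f_equal; ring.
  - intros x y; unfold g.
    apply is_derive_ext with (fun s => (V (x0 + s) (y0 + y) - V (x0 - s) (y0 + y)) / 2
      - (k * (y * y + s * (2 * d - s)) + h / 2 * (s * (d - s)))); [intros s; simpl; ring |].
    eapply (is_derive_half_diff (fun s => V (x0 + s) (y0 + y)) (fun s => V (x0 - s) (y0 + y))).
    + apply (is_derive_shift (fun s => V s (y0 + y))), Hx.
    + apply (is_derive_reflect (fun s => V s (y0 + y))), Hx.
    + instantiate (1 := k * (2 * d - 2 * x) + h / 2 * (d - 2 * x)); auto_derive; auto; field.
    + field.
  - intros x y.
    apply is_derive_ext with (fun s => (Vx (x0 + s) (y0 + y) - - Vx (x0 - s) (y0 + y)) / 2
      - (k * (2 * d - 2 * s) + h / 2 * (d - 2 * s))); [intros s; simpl; field |].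
    eapply (is_derive_half_diff (fun s => Vx (x0 + s) (y0 + y)) (fun s => - Vx (x0 - s) (y0 + y))).
    + apply (is_derive_shift (fun s => Vx s (y0 + y))), Hxx.
    + apply (is_derive_opp (V := R_NormedModule) (fun s => Vx (x0 - s) (y0 + y))).
      apply (is_derive_reflect (fun s => Vx s (y0 + y))), Hxx.
    + instantiate (1 := - (2 * k) - h); auto_derive; auto; field.
    + unfold opp; simpl; field.
  - intros x y; unfold g.
    apply is_derive_ext with (fun s => (V (x0 + x) (y0 + s) - V (x0 - x) (y0 + s)) / 2
      - (k * (s * s + x * (2 * d - x)) + h / 2 * (x * (d - x)))); [intros s; simpl; ring |].
    eapply (is_derive_half_diff (fun s => V (x0 + x) (y0 + s)) (fun s => V (x0 - x) (y0 + s))).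
    + apply (is_derive_shift (V (x0 + x))), Hy.
    + apply (is_derive_shift (V (x0 - x))), Hy.
    + instantiate (1 := k * (2 * y)); auto_derive; auto; field.
    + field.
  - intros x y.
    eapply (is_derive_half_diff (fun s => Vy (x0 + x) (y0 + s)) (fun s => Vy (x0 - x) (y0 + s))).
    + apply (is_derive_shift (Vy (x0 + x))), Hyy.
    + apply (is_derive_shift (Vy (x0 - x))), Hyy.
    + instantiate (1 := 2 * k); auto_derive; auto; field.
    + field.
  - intros x y Hx1 Hy1.
    assert (A1 := Hh (x0 + x) (y0 + y)); assert (A2 := Hh (x0 - x) (y0 + y)).
    specialize (A1 ltac:(apply Rabs_le_between; lra) ltac:(apply Rabs_le_between; lra)).
    specialize (A2 ltac:(apply Rabs_le_between; lra) ltac:(apply Rabs_le_between; lra)).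
    apply Rabs_lt_between in A1; apply Rabs_lt_between in A2; lra.
  - assert (Hz : Rabs (x0 - x0) <= d /\ Rabs (y0 - y0) <= d)
      by (rewrite !Rminus_diag, Rabs_R0; lra).
    assert (HM0 : 0 <= M).
    { generalize (HM x0 y0 (proj1 Hz) (proj2 Hz)) (Rabs_pos (V x0 y0)); lra. }
    assert (Hh0 : 0 < h).
    { generalize (Hh x0 y0 (proj1 Hz) (proj2 Hz)) (Rabs_pos (Vxx x0 y0 + Vyy x0 y0)); lra. }
    assert (Hk : k * (d * d) = M) by (unfold k; field; lra).
    assert (Hk0 : 0 <= k).
    { unfold k; apply Rmult_le_pos; [lra | apply Rlt_le, Rinv_0_lt_compat; nra]. }
    intros x y Hx1 Hy1 Hb; unfold g.
    assert (A1 := HM (x0 + x) (y0 + y)); assert (A2 := HM (x0 - x) (y0 + y)).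
    specialize (A1 ltac:(apply Rabs_le_between; lra) ltac:(apply Rabs_le_between; lra)).
    specialize (A2 ltac:(apply Rabs_le_between; lra) ltac:(apply Rabs_le_between; lra)).
    apply Rabs_le_between in A1; apply Rabs_le_between in A2.
    assert (A3 : 0 <= h / 2 * (x * (d - x))).
    { apply Rmult_le_pos; [lra | apply Rmult_le_pos; lra]. }
    (* On the side [x = 0] the odd part of [V] vanishes. *)
    destruct (Req_dec x 0) as [-> | Hx0'].
    { rewrite Rplus_0_r, Rminus_0_r.
      assert (0 <= k * (y * y)) by (apply Rmult_le_pos; [lra | nra]).
      lra. }
    assert (A4 : M <= k * (y * y + x * (2 * d - x))).
    { rewrite <- Hk; apply Rmult_le_compat_l; [lra |].
      destruct Hb as [-> | [-> | [-> | ->]]]; nra. }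
    lra. }
(* Since [g 0 0 = 0] and [g <= 0] on the half square, [g s 0] is maximal at [s = 0]. Its right
   derivative there is the left-hand side. *)
assert (Hder : Vx x0 y0 - 2 * M / d - h * d / 2 <= 0).
{ apply (derive_le_0_at_left_max (fun s => g s 0) 0 _ d Hd).
  - unfold g.
    apply is_derive_ext with (fun s => (V (x0 + s) (y0 + 0) - V (x0 - s) (y0 + 0)) / 2
      - (k * (0 * 0 + s * (2 * d - s)) + h / 2 * (s * (d - s)))); [intros s; simpl; ring |].
    eapply (is_derive_half_diff (fun s => V (x0 + s) (y0 + 0)) (fun s => V (x0 - s) (y0 + 0))).
    + apply (is_derive_shift (fun s => V s (y0 + 0))), Hx.
    + apply (is_derive_reflect (fun s => V s (y0 + 0))), Hx.
    + instantiate (1 := k * (2 * d) + h / 2 * d); auto_derive; auto; field.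
    + rewrite !Rplus_0_r, Rminus_0_r; unfold k; field; lra.
  - intros s Hs; apply Rle_trans with 0; [apply Hg; lra |].
    unfold g; rewrite !Rplus_0_r, Rminus_0_r; right; field. }
lra.
Qed.

(** * Estimates for smooth complex functions *)

Lemma abs_partial_x_le (V Vx Vy Vxx Vyy : R -> R -> R) (x0 y0 d M h : R) : 0 < d ->
  (forall x y, continuity_2d_pt V x y) ->
  (forall x y, is_derive (fun s => V s y) x (Vx x y)) ->
  (forall x y, is_derive (fun s => Vx s y) x (Vxx x y)) ->
  (forall x y, is_derive (V x) y (Vy x y)) ->
  (forall x y, is_derive (Vy x) y (Vyy x y)) ->
  (forall x y, Rabs (x - x0) <= d -> Rabs (y - y0) <= d -> Rabs (V x y) <= M) ->
  (forall x y, Rabs (x - x0) <= d -> Rabs (y - y0) <= d -> Rabs (Vxx x y + Vyy x y) <= h) ->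
  Rabs (Vx x0 y0) <= 2 * M / d + h * d / 2.
Proof.
intros Hd Hc Hx Hxx Hy Hyy HM Hh; apply Rle_plus_epsilon; intros k Hk.
(* The previous lemma wants a strict bound on the Laplacian. A slack of [2 * k / d] in that bound
   costs exactly [k] in the estimate. *)
assert (Hk' : h < h + 2 * k / d).
{ assert (0 < 2 * k / d) by (apply Rdiv_lt_0_compat; lra); lra. }
replace (2 * M / d + h * d / 2 + k) with (2 * M / d + (h + 2 * k / d) * d / 2) by (field; lra).
apply Rabs_le; split.
- apply Ropp_le_cancel; rewrite Ropp_involutive.
  apply (partial_x_le (fun x y => - V x y) (fun x y => - Vx x y) (fun x y => - Vy x y)
    (fun x y => - Vxx x y) (fun x y => - Vyy x y)); auto.
  + intros x y; now apply continuity_2d_pt_opp.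
  + intros x y; apply (is_derive_opp (V := R_NormedModule) (fun s => V s y)), Hx.
  + intros x y; apply (is_derive_opp (V := R_NormedModule) (fun s => Vx s y)), Hxx.
  + intros x y; apply (is_derive_opp (V := R_NormedModule) (V x)), Hy.
  + intros x y; apply (is_derive_opp (V := R_NormedModule) (Vy x)), Hyy.
  + intros x y Hx1 Hy1; rewrite Rabs_Ropp; auto.
  + intros x y Hx1 Hy1; rewrite <- Ropp_plus_distr, Rabs_Ropp.
    apply Rle_lt_trans with h; auto.
- apply (partial_x_le V Vx Vy Vxx Vyy); auto.
  intros x y Hx1 Hy1; apply Rle_lt_trans with h; auto.
Qed.

Definition laplacian (f : C -> C) : C -> C := lin 1 (Dx (Dx f)) (Dy (Dy f)).

Lemma Cmod_Ci : Cmod Ci = 1.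
Proof.
unfold Cmod, Ci; simpl; replace (0 * (0 * 1) + 1 * (1 * 1)) with 1 by ring.
apply sqrt_1.
Qed.

Lemma Cmod_le_sum (z : C) : Cmod z <= Rabs (Re z) + Rabs (Im z).
Proof.
destruct z as [a b].
replace ((a, b) : C) with (a + b * Ci)%C
  by (unfold Cplus, Cmult, RtoC, Ci; simpl; f_equal; ring).
apply Rle_trans with (1 := Cmod_triangle _ _).
rewrite Cmod_mult, !Cmod_R, Cmod_Ci; simpl.
right; f_equal; [f_equal; ring | rewrite Rmult_1_r; f_equal; ring].
Qed.

Lemma Re_abs_le (z : C) : Rabs (Re z) <= Cmod z.
Proof. apply Rle_trans with (2 := Rmax_Cmod z), Rmax_l. Qed.

Lemma Im_abs_le (z : C) : Rabs (Im z) <= Cmod z.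
Proof. apply Rle_trans with (2 := Rmax_Cmod z), Rmax_r. Qed.

Lemma in_disc_of_square (z : C) (x y d : R) :
  Rabs (x - Re z) <= d -> Rabs (y - Im z) <= d -> Cmod ((x, y) - z)%C <= 2 * d.
Proof.
intros Hx Hy; apply Rle_trans with (1 := Cmod_le_sum _); destruct z as [a b].
unfold Cminus, Cplus, Copp, Re, Im in *; simpl in *; unfold Rminus in *; lra.
Qed.

Lemma smooth_is_derive f : smooth f -> forall x y,
  is_derive (fun s => Re (f (s, y))) x (Re (Dx f (x, y))) /\
  is_derive (fun s => Im (f (s, y))) x (Im (Dx f (x, y))) /\
  is_derive (fun s => Re (f (x, s))) y (Re (Dy f (x, y))) /\
  is_derive (fun s => Im (f (x, s))) y (Im (Dy f (x, y))).
Proof.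
intros Hf x y; destruct (smooth_partials f Hf (x, y)) as [H1 [H2 [H3 H4]]].
repeat split; now apply Derive_correct.
Qed.

(** The square of half side [d] lies in the disc of radius [2 * d], so the real estimate applies to
    the real and imaginary parts. Adding the two bounds doubles the constants. *)
Lemma Dx_bound f z d M h : 0 < d -> smooth f ->
  (forall w, Cmod (w - z)%C <= 2 * d -> Cmod (f w) <= M) ->
  (forall w, Cmod (w - z)%C <= 2 * d -> Cmod (laplacian f w) <= h) ->
  Cmod (Dx f z) <= 4 / d * M + h * d.
Proof.
intros Hd Hf HM Hh; apply Rle_trans with (1 := Cmod_le_sum _).
assert (H1 := smooth_is_derive _ Hf).
assert (H2 := smooth_is_derive _ (smooth_Dx _ Hf)).
assert (H3 := smooth_is_derive _ (smooth_Dy _ Hf)).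
assert (L : forall x y, laplacian f (x, y) =
  (Re (Dx (Dx f) (x, y)) + Re (Dy (Dy f) (x, y)), Im (Dx (Dx f) (x, y)) + Im (Dy (Dy f) (x, y)))).
{ intros x y; unfold laplacian, lin; destruct (Dx (Dx f) (x, y)), (Dy (Dy f) (x, y)).
  unfold Cmult, Cplus, RtoC, Re, Im; simpl; f_equal; ring. }
assert (A1 : Rabs (Re (Dx f (Re z, Im z))) <= 2 * M / d + h * d / 2).
{ apply (abs_partial_x_le (fun x y => Re (f (x, y))) (fun x y => Re (Dx f (x, y)))
    (fun x y => Re (Dy f (x, y))) (fun x y => Re (Dx (Dx f) (x, y)))
    (fun x y => Re (Dy (Dy f) (x, y)))).
  - exact Hd.
  - intros x y; apply (continuity_2d_Re f (x, y)), smooth_continuous, Hf.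
  - intros x y; exact (proj1 (H1 x y)).
  - intros x y; exact (proj1 (H2 x y)).
  - intros x y; exact (proj1 (proj2 (proj2 (H1 x y)))).
  - intros x y; exact (proj1 (proj2 (proj2 (H3 x y)))).
  - intros x y Hx Hy; apply Rle_trans with (1 := Re_abs_le _), HM; now apply in_disc_of_square.
  - intros x y Hx Hy; apply Rle_trans with (2 := Hh (x, y) (in_disc_of_square z x y d Hx Hy)).
    rewrite L; apply (Re_abs_le (_, _)). }
assert (A2 : Rabs (Im (Dx f (Re z, Im z))) <= 2 * M / d + h * d / 2).
{ apply (abs_partial_x_le (fun x y => Im (f (x, y))) (fun x y => Im (Dx f (x, y)))
    (fun x y => Im (Dy f (x, y))) (fun x y => Im (Dx (Dx f) (x, y)))
    (fun x y => Im (Dy (Dy f) (x, y)))).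
  - exact Hd.
  - intros x y; apply (continuity_2d_Im f (x, y)), smooth_continuous, Hf.
  - intros x y; exact (proj1 (proj2 (H1 x y))).
  - intros x y; exact (proj1 (proj2 (H2 x y))).
  - intros x y; exact (proj2 (proj2 (proj2 (H1 x y)))).
  - intros x y; exact (proj2 (proj2 (proj2 (H3 x y)))).
  - intros x y Hx Hy; apply Rle_trans with (1 := Im_abs_le _), HM; now apply in_disc_of_square.
  - intros x y Hx Hy; apply Rle_trans with (2 := Hh (x, y) (in_disc_of_square z x y d Hx Hy)).
    rewrite L; apply (Im_abs_le (_, _)). }
replace (Re z, Im z) with z in * by now destruct z.
replace (4 / d * M + h * d) with ((2 * M / d + h * d / 2) + (2 * M / d + h * d / 2))
  by (field; lra).
lra.
Qed.

Lemma Cmod_sub_triangle (x y z : C) : Cmod (x - z)%C <= Cmod (x - y)%C + Cmod (y - z)%C.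
Proof.
replace (x - z)%C with ((x - y) + (y - z))%C by ring; apply Cmod_triangle.
Qed.

Lemma smooth_iter_Dx j f : smooth f -> smooth (Nat.iter j Dx f).
Proof. intros Hf; now apply (smooth_pder j 0). Qed.

Lemma one_le_pow (a : R) (n : nat) : 0 <= a -> 1 <= (1 + a) ^ n.
Proof. intros Ha; apply pow_R1_Rle; lra. Qed.

(** Each derivative costs a margin of [2 * d] in the radius. It multiplies the previous bound by
    [4 / d] and adds an error [h * d]; the factor [INR K * (1 + 4 / d) ^ K] is a crude bound for the
    resulting geometric sum. *)
Lemma iterated_Dx_bound f c r d M h K : 0 < d -> 0 <= h -> smooth f ->
  (forall z, Cmod (z - c)%C <= r -> Cmod (f z) <= M) ->
  (forall j z, (j < K)%nat -> Cmod (z - c)%C <= r ->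
    Cmod (laplacian (Nat.iter j Dx f) z) <= h) ->
  forall z, Cmod (z - c)%C <= r - 2 * d * INR K ->
  Cmod (Nat.iter K Dx f z) <= (4 / d) ^ K * M + INR K * (1 + 4 / d) ^ K * (h * d).
Proof.
intros Hd Hh0 Hf HM Hh; assert (Hd4 : 0 < 4 / d) by (apply Rdiv_lt_0_compat; lra).
induction K as [|K IH]; intros z Hz.
- simpl in *; rewrite !Rmult_0_l, Rmult_1_l, Rplus_0_r; apply HM; lra.
- rewrite S_INR in *; simpl.
  assert (Hhd : 0 <= h * d) by nra.
  assert (HK := pos_INR K); assert (Hp := one_le_pow (4 / d) K ltac:(lra)).
  apply Rle_trans with (4 / d * ((4 / d) ^ K * M + INR K * (1 + 4 / d) ^ K * (h * d)) + h * d).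
  + apply Dx_bound; auto using smooth_iter_Dx.
    * intros w Hw; apply IH; [intros j t Hj; apply Hh; lia |].
      generalize (Cmod_sub_triangle w z c); lra.
    * intros w Hw; apply Hh; [lia |].
      generalize (Cmod_sub_triangle w z c); nra.
  + assert (0 <= INR K * (1 + 4 / d) ^ K) by nra.
    assert (1 + 4 / d * (INR K * (1 + 4 / d) ^ K) <=
      (INR K + 1) * ((1 + 4 / d) * (1 + 4 / d) ^ K)) by nra.
    nra.
Qed.

(* This is [- 2 i] times [dbar f]. *)
Definition CR_defect (f : C -> C) : C -> C := lin (- Ci) (Dx f) (Dy f).

Lemma Dy_bound f z : Cmod (Dy f z) <= Cmod (Dx f z) + Cmod (CR_defect f z).
Proof.
replace (Dy f z) with (Ci * Dx f z + CR_defect f z)%C by (unfold CR_defect, lin; ring).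
apply Rle_trans with (1 := Cmod_triangle _ _); rewrite Cmod_mult.
rewrite Cmod_Ci; lra.
Qed.

(** The increment is taken along a horizontal and a vertical segment. The [y]-derivative is
    controlled by the [x]-derivative and the defect, and the bounds for the real and imaginary parts
    are added. *)
Lemma increment_bound f c r E h : smooth f ->
  (forall z, Cmod (z - c)%C <= r -> Cmod (Dx f z) <= E) ->
  (forall z, Cmod (z - c)%C <= r -> Cmod (CR_defect f z) <= h) ->
  forall z, Cmod (z - c)%C <= r -> Cmod (f z - f c)%C <= 4 * r * E + 2 * r * h.
Proof.
intros Hf HE Hh z Hz.
assert (Hsym : forall a b : C, Cmod (a - b)%C = Cmod (b - a)%C).
{ intros a b; rewrite <- Cmod_opp; f_equal; ring. }
assert (HDy : forall z, Cmod (z - c)%C <= r -> Cmod (Dy f z) <= E + h).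
{ intros w Hw; apply Rle_trans with (1 := Dy_bound f w), Rplus_le_compat; auto. }
assert (Hr : 0 <= r) by (apply Rle_trans with (2 := Hz), Cmod_ge_0).
assert (key : forall g : R -> R -> R,
  (forall v t, ex_derive (fun s => g s v) t) -> (forall v t, ex_derive (g v) t) ->
  (forall w, Rabs (Derive (fun s => g s (Im w)) (Re w)) <= Cmod (Dx f w)) ->
  (forall w, Rabs (Derive (g (Re w)) (Im w)) <= Cmod (Dy f w)) ->
  Rabs (g (Re c) (Im c) - g (Re z) (Im z)) <= r * E + r * (E + h)).
(* With the centre as first argument, both intermediate points are at distance at most
   [Cmod (c - z)] from [c], hence in the disc. *)
{ intros g G1 G2 G3 G4; destruct (MVT_2d g c z G1 G2) as [[p q] [P1 [P2 ->]]]; cbn [fst snd] in *.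
  rewrite Hsym, (Hsym c z) in P1; rewrite Hsym, (Hsym c z) in P2.
  apply Rle_trans with (1 := Rabs_triang _ _); rewrite !Rabs_mult.
  rewrite (Rmult_comm r), (Rmult_comm r (E + h)).
  apply Rplus_le_compat; apply Rmult_le_compat; auto using Rabs_pos.
  - apply Rle_trans with (1 := G3 _), HE; lra.
  - apply Rle_trans with (1 := re_le_Cmod _); rewrite Hsym; lra.
  - apply Rle_trans with (1 := G4 _), HDy; lra.
  - apply Rle_trans with (1 := Im_abs_le _); rewrite Hsym; lra. }
rewrite Hsym; apply Rle_trans with (1 := Cmod_le_sum _).
assert (A1 : Rabs (Re (f c - f z)%C) <= r * E + r * (E + h)).
{ replace (Re (f c - f z)%C) with
    ((fun s t => Re (f (s, t))) (Re c) (Im c) - (fun s t => Re (f (s, t))) (Re z) (Im z))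
    by (destruct c, z; reflexivity).
  apply (key (fun s t => Re (f (s, t)))).
  - intros v t; exact (proj1 (smooth_partials f Hf (t, v))).
  - intros v t; exact (proj1 (proj2 (proj2 (smooth_partials f Hf (v, t))))).
  - intros w; apply (Re_abs_le (Dx f w)).
  - intros w; apply (Re_abs_le (Dy f w)). }
assert (A2 : Rabs (Im (f c - f z)%C) <= r * E + r * (E + h)).
{ replace (Im (f c - f z)%C) with
    ((fun s t => Im (f (s, t))) (Re c) (Im c) - (fun s t => Im (f (s, t))) (Re z) (Im z))
    by (destruct c, z; reflexivity).
  apply (key (fun s t => Im (f (s, t)))).
  - intros v t; exact (proj1 (proj2 (smooth_partials f Hf (t, v)))).
  - intros v t; exact (proj2 (proj2 (proj2 (smooth_partials f Hf (v, t))))).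
  - intros w; apply (Im_abs_le (Dx f w)).
  - intros w; apply (Im_abs_le (Dy f w)). }
lra.
Qed.

(* Taylor's formula at a point where the first [K] derivatives are small, without the factor
   [/ K!] which is not needed. *)
Lemma taylor_bound K f c r B h : smooth f -> 0 <= h ->
  (forall j, (j < K)%nat -> Cmod (Nat.iter j Dx f c) <= h) ->
  (forall j z, (j < K)%nat -> Cmod (z - c)%C <= r ->
    Cmod (CR_defect (Nat.iter j Dx f) z) <= h) ->
  (forall z, Cmod (z - c)%C <= r -> Cmod (Nat.iter K Dx f z) <= B) ->
  forall z, Cmod (z - c)%C <= r ->
  Cmod (f z) <= (4 * r) ^ K * B + INR K * (1 + 4 * r) ^ K * h.
Proof.
revert f; induction K as [|K IH]; intros f Hf Hh Hc HCR HB z Hz.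
- simpl in *; rewrite !Rmult_0_l, Rmult_1_l, Rplus_0_r; auto.
- assert (Hr : 0 <= r) by (apply Rle_trans with (2 := Hz), Cmod_ge_0).
  assert (IH' : forall z, Cmod (z - c)%C <= r ->
    Cmod (Dx f z) <= (4 * r) ^ K * B + INR K * (1 + 4 * r) ^ K * h).
  { apply IH; auto using smooth_Dx.
    - intros j Hj; rewrite <- Nat.iter_succ_r; apply Hc; lia.
    - intros j w Hj; rewrite <- Nat.iter_succ_r; apply HCR; lia.
    - intros w; rewrite <- Nat.iter_succ_r; apply HB. }
  assert (H1 := increment_bound f c r _ h Hf IH' (fun z => HCR O z (Nat.lt_0_succ K)) z Hz).
  assert (H2 := Hc O (Nat.lt_0_succ K)); simpl in H2.
  assert (H3 := Cmod_triangle (f z - f c) (f c)).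
  replace (f z - f c + f c)%C with (f z) in H3 by ring.
  rewrite S_INR; simpl.
  assert (HK := pos_INR K); assert (Hp := one_le_pow (4 * r) K ltac:(lra)).
  set (q := (1 + 4 * r) ^ K) in *.
  assert (0 <= INR K * q) by nra.
  (* The three terms on the left are the coefficients of [h] coming from the value at [c], from the
     defect, and from the error inherited from [Dx f]. *)
  assert (A : 1 + 2 * r + 4 * r * (INR K * q) <= (INR K + 1) * ((1 + 4 * r) * q)) by nra.
  apply (Rmult_le_compat_r h) in A; auto; nra.
Qed.

(** * Monomials *)

(** Monomials are differentiated as curves along horizontal and vertical lines, so that one product
    rule serves both partial derivatives. *)
Definition is_derive_C (g : R -> C) (t : R) (l : C) : Prop :=
  is_derive (fun s => Re (g s)) t (Re l) /\ is_derive (fun s => Im (g s)) t (Im l).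

Lemma is_derive_C_const a t : is_derive_C (fun _ => a) t 0%C.
Proof. split; apply (is_derive_const (V := R_NormedModule)). Qed.

Lemma is_derive_C_mult f g t a b : is_derive_C f t a -> is_derive_C g t b ->
  is_derive_C (fun s => f s * g s)%C t (a * g t + f t * b)%C.
Proof.
intros [F1 F2] [G1 G2].
assert (P : forall (p q : R -> R) (u v : R), is_derive p t u -> is_derive q t v ->
  is_derive (fun s => p s * q s) t (u * q t + p t * v)).
{ intros p q u v Hp Hq; apply (is_derive_mult p q t u v Hp Hq).
  intros; apply Rmult_comm. }
destruct a as [a1 a2], b as [b1 b2]; split; simpl in *.
- eapply is_derive_ext with (f := fun s => Re (f s) * Re (g s) - Im (f s) * Im (g s)).
  { intros s; reflexivity. }
  replace (a1 * fst (g t) - a2 * snd (g t) + (fst (f t) * b1 - snd (f t) * b2))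
    with ((a1 * Re (g t) + Re (f t) * b1) - (a2 * Im (g t) + Im (f t) * b2))
    by (unfold Re, Im; ring).
  apply (is_derive_minus (V := R_NormedModule)); apply P; assumption.
- eapply is_derive_ext with (f := fun s => Re (f s) * Im (g s) + Im (f s) * Re (g s)).
  { intros s; reflexivity. }
  replace (a1 * snd (g t) + a2 * fst (g t) + (fst (f t) * b2 + snd (f t) * b1))
    with ((a1 * Im (g t) + Re (f t) * b2) + (a2 * Re (g t) + Im (f t) * b1))
    by (unfold Re, Im; ring).
  apply (is_derive_plus (V := R_NormedModule)); apply P; assumption.
Qed.

Definition monomial (a c : C) (n : nat) (z : C) : C := (a * Cpow (z - c) n)%C.

Lemma is_derive_C_pow f t l n : is_derive_C f t l ->
  is_derive_C (fun s => Cpow (f s) (S n)) t (RtoC (INR (S n)) * Cpow (f t) n * l)%C.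
Proof.
intros Hf; induction n as [|n IH].
- generalize (is_derive_C_mult f (fun _ => RtoC 1) t l 0 Hf (is_derive_C_const _ _)).
  replace (l * 1 + f t * 0)%C with (RtoC (INR 1) * Cpow (f t) 0 * l)%C; [auto |].
  simpl; ring.
- generalize (is_derive_C_mult f (fun s => Cpow (f s) (S n)) t l _ Hf IH).
  replace (l * Cpow (f t) (S n) + f t * (INR (S n) * Cpow (f t) n * l))%C
    with (RtoC (INR (S (S n))) * Cpow (f t) (S n) * l)%C; [auto |].
  rewrite (S_INR (S n)), RtoC_plus; simpl Cpow; ring.
Qed.

Lemma partials_of_is_derive_C f z lx ly :
  is_derive_C (fun t => f (t, Im z)) (Re z) lx -> is_derive_C (fun t => f (Re z, t)) (Im z) ly ->
  ex_partials f z /\ Dx f z = lx /\ Dy f z = ly.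
Proof.
intros [X1 X2] [Y1 Y2]; split; [| split].
- repeat split; eexists; eassumption.
- destruct lx; unfold Dx; f_equal; apply is_derive_unique; assumption.
- destruct ly; unfold Dy; f_equal; apply is_derive_unique; assumption.
Qed.

Lemma is_derive_C_x_minus (c : C) (x y : R) : is_derive_C (fun t => (t, y) - c)%C x 1%C.
Proof. split; destruct c as [c1 c2]; simpl; auto_derive; auto. Qed.

Lemma is_derive_C_y_minus (c : C) (x y : R) : is_derive_C (fun t => (x, t) - c)%C y Ci.
Proof. split; destruct c as [c1 c2]; simpl; auto_derive; auto. Qed.

Lemma monomial_S_partials a c n z : ex_partials (monomial a c (S n)) z /\
  Dx (monomial a c (S n)) z = monomial (RtoC (INR (S n)) * a)%C c n z /\
  Dy (monomial a c (S n)) z = monomial (Ci * (RtoC (INR (S n)) * a))%C c n z.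
Proof.
apply partials_of_is_derive_C; destruct z as [x y]; unfold monomial;
  change (Re (x, y)) with x; change (Im (x, y)) with y.
- generalize (is_derive_C_mult (fun _ => a) _ x 0 _ (is_derive_C_const a x)
    (is_derive_C_pow _ x _ n (is_derive_C_x_minus c x y))); cbv beta.
  match goal with |- is_derive_C _ _ ?l -> is_derive_C _ _ ?m =>
    replace l with m; [auto | ring] end.
- generalize (is_derive_C_mult (fun _ => a) _ y 0 _ (is_derive_C_const a y)
    (is_derive_C_pow _ y _ n (is_derive_C_y_minus c x y))); cbv beta.
  match goal with |- is_derive_C _ _ ?l -> is_derive_C _ _ ?m =>
    replace l with m; [auto | ring] end.
Qed.

Lemma Dx_monomial_S a c n :
  Dx (monomial a c (S n)) = monomial (RtoC (INR (S n)) * a)%C c n.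
Proof. apply functional_extensionality; intros z; apply monomial_S_partials. Qed.

Lemma Dy_monomial_S a c n :
  Dy (monomial a c (S n)) = monomial (Ci * (RtoC (INR (S n)) * a))%C c n.
Proof. apply functional_extensionality; intros z; apply monomial_S_partials. Qed.

Lemma monomial_0 a c : monomial a c 0 = fun _ => a.
Proof. apply functional_extensionality; intros z; unfold monomial; simpl; ring. Qed.

Lemma continuous_monomial a c n z : continuous (monomial a c n) z.
Proof.
revert a; induction n as [|n IH]; intros a.
{ rewrite monomial_0; apply continuous_const. }
assert (Hre : forall h : C -> C, continuous h z -> continuous (fun w => Re (h w)) z).
{ intros h Hh; apply (continuous_comp h (fun w : C => fst w) z Hh).
  destruct (h z) as [u v]; apply continuous_fst. }
assert (Him : forall h : C -> C, continuous h z -> continuous (fun w => Im (h w)) z).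
{ intros h Hh; apply (continuous_comp h (fun w : C => snd w) z Hh).
  destruct (h z) as [u v]; apply continuous_snd. }
assert (H1 : continuous (fun w : C => Re w - Re c) z).
{ apply (continuous_minus (V := R_NormedModule) (fun w : C => Re w) (fun _ => Re c));
    [apply (Hre (fun w => w)), continuous_id | apply continuous_const]. }
assert (H2 : continuous (fun w : C => Im w - Im c) z).
{ apply (continuous_minus (V := R_NormedModule) (fun w : C => Im w) (fun _ => Im c));
    [apply (Him (fun w => w)), continuous_id | apply continuous_const]. }
apply continuous_ext with (fun w =>
  ((fun p q : R => (p, q) : C)
  ((Re w - Re c) * Re (monomial a c n w) - (Im w - Im c) * Im (monomial a c n w))
  ((Re w - Re c) * Im (monomial a c n w) + (Im w - Im c) * Re (monomial a c n w)))).
{ intros w; unfold monomial; simpl Cpow.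
  replace (a * ((w - c) * Cpow (w - c) n))%C with ((w - c) * (a * Cpow (w - c) n))%C by ring.
  destruct (a * Cpow (w - c) n)%C as [p q], w as [w1 w2], c as [c1 c2].
  unfold Cmult, Cminus, Cplus, Copp, Re, Im; simpl; f_equal; ring. }
apply continuous_comp_2.
- apply (continuous_minus (V := R_NormedModule)); apply (continuous_mult (K := R_AbsRing)); auto.
- apply (continuous_plus (V := R_NormedModule)); apply (continuous_mult (K := R_AbsRing)); auto.
- apply continuous_ext with (fun w : C => w); [now intros [u v] | apply continuous_id].
Qed.

Lemma smooth_monomial a c n : smooth (monomial a c n).
Proof.
intros m; revert a n; induction m as [|m IH]; intros a n.
- split; auto; intros z; apply continuous_monomial.
- destruct n as [|n]; [rewrite monomial_0; apply smooth_const |].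
  split; [intros z; apply continuous_monomial |].
  split; [intros z; apply monomial_S_partials |].
  rewrite Dx_monomial_S, Dy_monomial_S; auto.
Qed.

(** Because of this, subtracting a monomial in [leading_jet_bound] leaves the defect unchanged. *)
Lemma CR_defect_monomial a c n z : CR_defect (monomial a c n) z = 0%C.
Proof.
unfold CR_defect, lin; destruct n as [|n].
- rewrite monomial_0; unfold Dx, Dy; rewrite !Derive_const.
  unfold Cplus, Cmult, RtoC, Copp; simpl; f_equal; ring.
- rewrite Dx_monomial_S, Dy_monomial_S; unfold monomial; ring.
Qed.

(* [falling n j = n! / (n - j)!] *)
Fixpoint falling (n j : nat) {struct j} : R :=
  match j, n with
  | O, _ => 1
  | S _, O => 0
  | S i, S m => INR n * falling m i
  end.

(** For [j > n] the truncated exponent [n - j] is 0, but [falling n j] is 0 as well, so the formula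
    remains correct. *)
Lemma iter_Dx_monomial j a c n :
  Nat.iter j Dx (monomial a c n) = monomial (RtoC (falling n j) * a)%C c (n - j).
Proof.
revert a n; induction j as [|j IH]; intros a n.
- rewrite Nat.sub_0_r; change (falling n 0) with 1.
  now replace (RtoC 1 * a)%C with a by ring.
- rewrite Nat.iter_succ_r; destruct n as [|n].
  + simpl falling; simpl Nat.sub; rewrite !monomial_0.
    replace (Dx (fun _ => a)) with (monomial 0 c 0).
    * rewrite IH; simpl Nat.sub; rewrite monomial_0; apply functional_extensionality; intros z; ring.
    * rewrite monomial_0; apply functional_extensionality; intros z; unfold Dx.
      now rewrite !Derive_const.
  + rewrite Dx_monomial_S, IH; simpl Nat.sub; unfold monomial.
    apply functional_extensionality; intros z.
    change (falling (S n) (S j)) with (INR (S n) * falling n j); rewrite RtoC_mult; ring.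
Qed.

Lemma falling_diag_pos n : 0 < falling n n.
Proof.
induction n as [|n IH]; [apply Rlt_0_1 |].
change (0 < INR (S n) * falling n n); apply Rmult_lt_0_compat; auto.
apply lt_0_INR; lia.
Qed.

Lemma falling_gt n j : (n < j)%nat -> falling n j = 0.
Proof.
revert n; induction j as [|j IH]; intros n Hn; [lia |]; destruct n as [|n]; [reflexivity |].
change (INR (S n) * falling n j = 0); rewrite IH by lia; ring.
Qed.

(** * Moderate and negligible bounds on discs *)

(** Real nets are embedded in the complex ones, so the closure properties of [moderate] and
    [negligible] carry over. *)
Definition real_moderate (f : index -> R) : Prop := moderate (fun e => RtoC (f e)).
Definition real_negligible (f : index -> R) : Prop := negligible (fun e => RtoC (f e)).

Lemma real_moderate_const a : real_moderate (fun _ => a).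
Proof. exact (moderate_const (RtoC a)). Qed.

Lemma real_moderate_plus f g : real_moderate f -> real_moderate g ->
  real_moderate (fun e => f e + g e).
Proof.
intros Hf Hg; unfold real_moderate.
replace (fun e => RtoC (f e + g e)) with (fun e => (RtoC (f e) + RtoC (g e))%C).
- now apply moderate_plus.
- apply functional_extensionality; intros e; now rewrite RtoC_plus.
Qed.

Lemma real_moderate_mult f g : real_moderate f -> real_moderate g ->
  real_moderate (fun e => f e * g e).
Proof.
intros Hf Hg; unfold real_moderate.
replace (fun e => RtoC (f e * g e)) with (fun e => (RtoC (f e) * RtoC (g e))%C).
- now apply moderate_mult.
- apply functional_extensionality; intros e; now rewrite RtoC_mult.
Qed.

Lemma real_moderate_pow f n : real_moderate f -> real_moderate (fun e => f e ^ n).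
Proof.
intros Hf; induction n as [|n IH]; simpl; [apply real_moderate_const |].
now apply real_moderate_mult.
Qed.

Lemma real_moderate_Cmod z : moderate z -> real_moderate (fun e => Cmod (z e)).
Proof.
intros [N HN]; exists N; revert HN; apply for_small_imp; intros e.
now rewrite Cmod_R, Rabs_pos_eq by apply Cmod_ge_0.
Qed.

Lemma real_negligible_Cmod z : negligible z -> real_negligible (fun e => Cmod (z e)).
Proof.
intros H; apply negligible_le with (2 := H); intros e.
rewrite Cmod_R, Rabs_pos_eq by apply Cmod_ge_0; apply Rle_refl.
Qed.

Lemma real_negligible_mult f g : real_moderate f -> real_negligible g ->
  real_negligible (fun e => f e * g e).
Proof.
intros Hf Hg; generalize (negligible_mult _ _ Hf Hg); apply negligible_ext.
intros e; now rewrite RtoC_mult.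
Qed.

Lemma real_negligible_plus f g : real_negligible f -> real_negligible g ->
  real_negligible (fun e => f e + g e).
Proof.
intros Hf Hg; generalize (negligible_plus _ _ Hf Hg); apply negligible_ext.
intros e; now rewrite RtoC_plus.
Qed.

Lemma real_negligible_le f m : real_negligible f -> for_small (fun e => f e <= e ^ m).
Proof.
intros H; generalize (H m); apply for_small_imp; intros e; rewrite Cmod_R.
intros H1; apply Rle_trans with (2 := H1), Rle_abs.
Qed.

Lemma real_moderate_le f : real_moderate f -> exists N : nat, for_small (fun e => f e <= / e ^ N).
Proof.
intros [N HN]; exists N; revert HN; apply for_small_imp; intros e; rewrite Cmod_R.
intros H1; apply Rle_trans with (2 := H1), Rle_abs.
Qed.

Lemma Rpower_pos a b : 0 < Rpower a b.
Proof. apply exp_pos. Qed.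

Lemma real_moderate_Rpower b : real_moderate (fun e => Rpower e b).
Proof.
destruct (INR_unbounded (- b)) as [N HN]; exists N; apply for_small_all; intros e.
rewrite Cmod_R, Rabs_pos_eq by apply Rlt_le, Rpower_pos.
rewrite <- (Rpower_pow N) by apply eps_range; rewrite <- Rpower_Ropp.
apply Rpower_eps_le; lra.
Qed.

Lemma for_small_Rpower_le (b C0 : R) : 0 < b -> 0 < C0 -> for_small (fun e => Rpower e b <= C0).
Proof.
intros Hb HC; generalize (for_small_le (Rpower C0 (/ b)) (Rpower_pos _ _)).
apply for_small_imp; intros e He.
apply Rle_trans with (Rpower (Rpower C0 (/ b)) b).
- apply Rle_Rpower_l; [lra | split; [apply eps_range | exact He]].
- rewrite Rpower_mult, Rinv_l, Rpower_1; lra.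
Qed.

(** The factor [Rpower e (b - a)] tends to 0 and absorbs the constant. *)
Lemma for_small_Rpower_mult_le (a b C0 : R) : a < b ->
  for_small (fun e => C0 * Rpower e b <= Rpower e a).
Proof.
intros Hab; generalize (for_small_Rpower_le (b - a) (/ (Rabs C0 + 1)) ltac:(lra)
  ltac:(apply Rinv_0_lt_compat; generalize (Rabs_pos C0); lra)).
apply for_small_imp; intros e He.
replace (Rpower e b) with (Rpower e (b - a) * Rpower e a)
  by (rewrite <- Rpower_plus; f_equal; ring).
assert (HC := Rabs_pos C0); assert (HC' := Rle_abs C0).
rewrite <- Rmult_assoc; apply Rle_trans with (1 * Rpower e a); [| lra].
apply Rmult_le_compat_r; [apply Rlt_le, Rpower_pos |].
assert (Hp := Rpower_pos e (b - a)).
apply Rle_trans with ((Rabs C0 + 1) * Rpower e (b - a)); [nra |].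
apply Rle_trans with ((Rabs C0 + 1) * / (Rabs C0 + 1)).
- apply Rmult_le_compat_l; lra.
- right; apply Rinv_r; lra.
Qed.

(** The squared modulus is maximised on the square of half side [r] around [c]. This square contains
    the disc of radius [r], and its points are within [2 * r] of [c]. *)
Lemma square_maximizer f (c : C) (r : R) : smooth f -> 0 <= r ->
  exists x : C, Cmod (x - c)%C <= 2 * r /\
    forall z, Cmod (z - c)%C <= r -> Cmod (f z) <= Cmod (f x).
Proof.
intros Hf Hr.
destruct (rectangle_max
  (fun s t => Re (f (s, t)) * Re (f (s, t)) + Im (f (s, t)) * Im (f (s, t)))
  (Re c - r) (Re c + r) (Im c - r) (Im c + r)) as [X [Y [HX [HY Hmax]]]]; try lra.
{ intros x y; assert (Hc := smooth_continuous f Hf).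
  assert (H1 := continuity_2d_Re f (x, y) Hc).
  assert (H2 := continuity_2d_Im f (x, y) Hc).
  apply continuity_2d_pt_plus; now apply continuity_2d_pt_mult. }
exists (X, Y); split.
- apply in_disc_of_square; apply Rabs_le; lra.
- intros z Hz.
  assert (H1 := Rle_trans _ _ _ (Re_abs_le (z - c)%C) Hz).
  assert (H2 := Rle_trans _ _ _ (Im_abs_le (z - c)%C) Hz).
  apply Rabs_le_between in H1; apply Rabs_le_between in H2.
  destruct z as [x y], c as [c1 c2]; simpl in H1, H2, Hmax.
  specialize (Hmax x y ltac:(lra) ltac:(lra)); unfold Re, Im in Hmax.
  unfold Cmod; apply sqrt_le_1_alt; simpl; lra.
Qed.

(** The norm is below [r] exactly when the valuation, a supremum of exponents, exceeds [- ln r].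
    Strictness yields an admissible exponent [b] above [- ln r], and every admissible exponent is at
    most the valuation. *)
Lemma sharp_norm_lt_iff (x c : mnet) (r : R) : 0 < r ->
  sharp_norm (minus (cls x : gC) (cls c)) < r <->
  exists b, - ln r < b /\ for_small (fun e => Cmod (x e - c e)%C <= Rpower e b).
Proof.
intros Hr.
assert (Hm : minus (cls x : gC) (cls c) = cls (mnet_plus x (mnet_opp c))).
{ unfold minus, plus, opp; simpl; now rewrite gC_opp_cls, gC_plus_cls. }
assert (Hn := val_neq_m_infty (minus (cls x : gC) (cls c))).
unfold sharp_norm; rewrite Hm in *; rewrite val_cls in *; unfold net_val in *.
assert (E : forall b, for_small (fun e => Cmod (mnet_plus x (mnet_opp c) e) <= Rpower e b) <->
  for_small (fun e => Cmod (x e - c e)%C <= Rpower e b)).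
{ intros b; replace (fun e => Cmod (x e - c e)%C <= Rpower e b) with
    (fun e => Cmod (mnet_plus x (mnet_opp c) e) <= Rpower e b); [tauto |].
  apply functional_extensionality; intros e.
  replace (mnet_plus x (mnet_opp c) e) with (x e - c e)%C by (simpl; ring); reflexivity. }
destruct (Lub_Rbar_correct
  (fun b : R => for_small (fun e => Cmod (mnet_plus x (mnet_opp c) e) <= Rpower e b)))
  as [Hub Hlub].
destruct Lub_Rbar as [v| |]; [| | easy].
- split.
  + intros H; apply NNPP; intros Hno.
    assert (Hv : Rbar_le v (- ln r)).
    { apply Hlub; intros b Hb; apply Rnot_lt_le; intros Hlt; apply Hno; exists b.
      split; auto; now apply E. }
    simpl in Hv; apply (Rlt_not_le _ _ H).
    rewrite <- (exp_ln r Hr) at 1; destruct (Req_dec (ln r) (- v)) as [-> |Hd]; [lra |].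
    apply Rlt_le, exp_increasing; lra.
  + intros [b [Hb1 Hb2]]; apply E in Hb2; generalize (Hub b Hb2); simpl; intros Hbv.
    rewrite <- (exp_ln r Hr); apply exp_increasing; lra.
- split; auto; intros _; apply NNPP; intros Hno.
  assert (Hv : Rbar_le p_infty (- ln r)).
  { apply Hlub; intros b Hb; apply Rnot_lt_le; intros Hlt; apply Hno; exists b.
    split; auto; now apply E. }
  exact Hv.
Qed.

Lemma disc_net_in_ball (c : mnet) (r b : R) (hr : 0 < r) (hb : - ln r < b) (y : index -> C) :
  (forall e, Cmod (y e - c e)%C <= 2 * Rpower e b) ->
  exists Y : mnet, net Y = y /\ sharp_ball (cls c) r (cls Y).
Proof.
intros Hy; assert (Hmod : moderate y).
{ assert (H : moderate (fun e => y e - c e)%C).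
  { destruct (real_moderate_mult _ _ (real_moderate_const 2) (real_moderate_Rpower b)) as [N HN].
    exists N; revert HN; apply for_small_imp; intros e; rewrite Cmod_R.
    intros H; apply Rle_trans with (2 := H); apply Rle_trans with (2 := Rle_abs _); auto. }
  generalize (moderate_plus _ _ H (net_moderate c)).
  replace (fun e => y e - c e + c e)%C with y; auto.
  apply functional_extensionality; intros e; ring. }
exists (MNet y Hmod); split; auto.
(* The midpoint of [- ln r] and [b] leaves room to absorb the factor 2. *)
apply sharp_norm_lt_iff; auto; exists ((b - ln r) / 2); split; [lra |].
generalize (for_small_Rpower_mult_le ((b - ln r) / 2) b 2 ltac:(lra)).
apply for_small_imp; intros e He; generalize (Hy e); simpl; lra.
Qed.

(** This turns conditions at generalized points into uniform bounds on discs: the maximisers for the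
    individual [e] form a net that represents a point of the ball, and the bound is the modulus of
    [f] along that net. *)
Lemma disc_sup (c : mnet) (r b : R) (hr : 0 < r) (hb : - ln r < b) f :
  (forall e, smooth (f e)) -> exists M : index -> R,
  (forall e, 0 <= M e) /\
  (forall e z, Cmod (z - c e)%C <= Rpower e b -> Cmod (f e z) <= M e) /\
  exists x : mnet, sharp_ball (cls c) r (cls x) /\ forall e, M e = Cmod (f e (x e)).
Proof.
intros Hf.
set (x := fun e => proj1_sig (constructive_indefinite_description _
  (square_maximizer (f e) (c e) (Rpower e b) (Hf e) (Rlt_le _ _ (Rpower_pos e b))))).
assert (Hx : forall e, Cmod (x e - c e)%C <= 2 * Rpower e b /\
    forall z, Cmod (z - c e)%C <= Rpower e b -> Cmod (f e z) <= Cmod (f e (x e))).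
{ intros e; unfold x; destruct constructive_indefinite_description; assumption. }
clearbody x; destruct (disc_net_in_ball c r b hr hb x) as [X [E HX]]; [apply Hx |].
exists (fun e => Cmod (f e (x e))); split; [| split].
- intros e; apply Cmod_ge_0.
- apply Hx.
- exists X; split; auto; now rewrite E.
Qed.

Lemma in_EM_disc_bound (c : mnet) (r b : R) (hr : 0 < r) (hb : - ln r < b) f :
  in_EM (sharp_ball (cls c) r) f -> exists M : index -> R,
  real_moderate M /\ (forall e, 0 <= M e) /\
  forall e z, Cmod (z - c e)%C <= Rpower e b -> Cmod (f e z) <= M e.
Proof.
intros [H1 H2]; destruct (disc_sup c r b hr hb f H1) as [M [M0 [HM [x [Hx Ex]]]]].
exists M; split; auto; generalize (real_moderate_Cmod _ (H2 O O x Hx)).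
apply functional_extensionality in Ex; now rewrite Ex.
Qed.

Lemma in_N_disc_bound (c : mnet) (r b : R) (hr : 0 < r) (hb : - ln r < b) f :
  in_N (sharp_ball (cls c) r) f -> exists M : index -> R,
  real_negligible M /\ (forall e, 0 <= M e) /\
  forall e z, Cmod (z - c e)%C <= Rpower e b -> Cmod (f e z) <= M e.
Proof.
intros [H1 H2]; destruct (disc_sup c r b hr hb f H1) as [M [M0 [HM [x [Hx Ex]]]]].
exists M; split; auto; generalize (real_negligible_Cmod _ (H2 O O x Hx)).
apply functional_extensionality in Ex; now rewrite Ex.
Qed.

(** Only the indices [j < K] occur, so the sum of the individual bounds is still negligible. *)
Lemma in_N_family_disc_bound (c : mnet) (r b : R) (hr : 0 < r) (hb : - ln r < b)
    (f : nat -> index -> C -> C) K :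
  (forall j, in_N (sharp_ball (cls c) r) (f j)) -> exists M : index -> R,
  real_negligible M /\ (forall e, 0 <= M e) /\
  forall e j z, (j < K)%nat -> Cmod (z - c e)%C <= Rpower e b -> Cmod (f j e z) <= M e.
Proof.
intros H; induction K as [|K [M [HM [M0 IH]]]].
- exists (fun _ => 0); split; [apply negligible_0 | split; [intros; lra | intros; lia]].
- destruct (in_N_disc_bound c r b hr hb _ (H K)) as [M' [HM' [M0' IH']]].
  exists (fun e => M e + M' e); split; [now apply real_negligible_plus | split].
  + intros e; generalize (M0 e) (M0' e); lra.
  + intros e j z Hj Hz; generalize (M0 e) (M0' e); destruct (Nat.eq_dec j K) as [-> |Hd].
    * generalize (IH' e z Hz); lra.
    * generalize (IH e j z ltac:(lia) Hz); lra.
Qed.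

Lemma negligible_family_bound (z : nat -> index -> C) K :
  (forall j, (j < K)%nat -> negligible (z j)) -> exists M : index -> R,
  real_negligible M /\ (forall e, 0 <= M e) /\
  forall e j, (j < K)%nat -> Cmod (z j e) <= M e.
Proof.
intros H; induction K as [|K IH].
- exists (fun _ => 0); split; [apply negligible_0 | split; [intros; lra | intros; lia]].
- destruct IH as [M [HM [M0 IH]]]; [auto |].
  exists (fun e => M e + Cmod (z K e)); split; [| split].
  + apply real_negligible_plus; auto; apply real_negligible_Cmod; auto.
  + intros e; generalize (M0 e) (Cmod_ge_0 (z K e)); lra.
  + intros e j Hj; generalize (M0 e) (Cmod_ge_0 (z K e)); destruct (Nat.eq_dec j K) as [-> |Hd].
    * lra.
    * generalize (IH e j ltac:(lia)); lra.
Qed.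

(** * The Cauchy-Riemann defect of nets, and vanishing from a zero jet *)

Lemma CR_defect_Dx f : smooth f -> CR_defect (Dx f) = Dx (CR_defect f).
Proof.
intros Hf; unfold CR_defect.
rewrite Dx_lin by auto using smooth_partials, smooth_Dx, smooth_Dy.
now rewrite Dx_Dy_comm.
Qed.

(** This is the factorisation of the Laplacian into two conjugate first-order operators. It makes
    the Laplacian negligible as soon as the defect is. *)
Lemma laplacian_CR_defect f : smooth f ->
  laplacian f = lin Ci (Dx (CR_defect f)) (Dy (CR_defect f)).
Proof.
intros Hf; unfold CR_defect.
rewrite Dx_lin, Dy_lin by auto using smooth_partials, smooth_Dx, smooth_Dy.
rewrite Dx_Dy_comm by assumption.
apply functional_extensionality; intros z; unfold laplacian, lin.
assert (Hi : (Ci * Ci)%C = (- (1))%C).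
{ unfold Ci, Cmult, Copp, RtoC; simpl; f_equal; ring. }
replace (Ci * (- Ci * Dx (Dx f) z + Dy (Dx f) z) + (- Ci * Dy (Dx f) z + Dy (Dy f) z))%C
  with (- (Ci * Ci) * Dx (Dx f) z + Dy (Dy f) z)%C by ring.
rewrite Hi; ring.
Qed.

Lemma in_EM_iter_Dx A w j : in_EM A w -> in_EM A (fun e => Nat.iter j Dx (w e)).
Proof. intros H; induction j as [|j IH]; simpl; auto; now apply in_EM_Dx. Qed.

Lemma in_N_CR_defect_iter A w j : (forall e, smooth (w e)) ->
  in_N A (fun e => CR_defect (w e)) -> in_N A (fun e => CR_defect (Nat.iter j Dx (w e))).
Proof.
intros Hw H; induction j as [|j IH]; simpl; auto.
generalize (in_N_Dx A _ IH); apply in_N_ext; intros e z.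
rewrite CR_defect_Dx; auto using smooth_iter_Dx.
Qed.

Lemma in_N_laplacian_iter A w j : (forall e, smooth (w e)) ->
  in_N A (fun e => CR_defect (w e)) -> in_N A (fun e => laplacian (Nat.iter j Dx (w e))).
Proof.
intros Hw H; assert (Hj := in_N_CR_defect_iter A w j Hw H).
generalize (in_N_lin A Ci _ _ (in_N_Dx A _ Hj) (in_N_Dy A _ Hj)).
apply in_N_ext; intros e z; rewrite laplacian_CR_defect; auto using smooth_iter_Dx.
Qed.

(** One spare power of [e] pays for adding two terms. *)
Lemma eps_pow_sum_le (e : index) (a b : R) (m : nat) :
  e <= / 2 -> a <= e ^ S m -> b <= e ^ S m -> a + b <= e ^ m.
Proof. simpl; intros He Ha Hb; generalize (eps_pow_pos e m); nra. Qed.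

(* Cauchy estimates bound [D^K] on the disc of radius [R/2] by [C M / R^K], where [R = eps^b'];
   Taylor's formula then gives [(C eps^b / R)^K M] at distance [eps^b], with [b' < b]. *)
Lemma vanishing_of_jet (c : mnet) (r : R) (hr : 0 < r) (w : index -> C -> C) :
  in_EM (sharp_ball (cls c) r) w ->
  in_N (sharp_ball (cls c) r) (fun e => CR_defect (w e)) ->
  (forall k, negligible (fun e => Nat.iter k Dx (w e) (c e))) ->
  forall x : mnet, sharp_ball (cls c) r (cls x) -> negligible (fun e => w e (x e)).
Proof.
intros Hw HCR Hjet x Hx.
destruct (proj1 (sharp_norm_lt_iff x c r hr) Hx) as [b [Hb Hxb]].
(* The midpoint of [- ln r] and [b]: the disc of radius [eps^b'] still consists of points of the
   ball, and it is larger than the disc of radius [eps^b] by a negative power of [eps]. *)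
set (b' := (b - ln r) / 2); assert (Hb1 : - ln r < b') by (unfold b'; lra).
assert (Hb2 : b' < b) by (unfold b'; lra); clearbody b'.
assert (Hs : forall e, smooth (w e)) by apply Hw.
destruct (in_EM_disc_bound c r b' hr Hb1 w Hw) as [M [HM [M0 HwM]]].
destruct (real_moderate_le M HM) as [N HN].
intros m.
(* [K] is chosen so that [eps^((b - b') * K)] is at most [eps^(N + m + 2)]. Here [eps^N] cancels the
   bound on [w], one further power absorbs the constant [(64 * INR K) ^ K], and another pays for the
   final sum. The successor makes [K] positive, as the division in [d] requires. *)
destruct (INR_unbounded ((INR (N + S (S m))) / (b - b'))) as [K' HK'].
set (K := S K').
assert (HK : INR (N + S (S m)) <= INR K * (b - b')).
{ apply (Rmult_lt_compat_r (b - b')) in HK'; [| lra].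
  replace (INR (N + S (S m)) / (b - b') * (b - b')) with (INR (N + S (S m))) in HK'
    by (field; lra).
  unfold K; rewrite S_INR; lra. }
assert (HK1 : 1 <= INR K).
{ unfold K; rewrite S_INR; generalize (pos_INR K'); lra. }
clearbody K; clear K' HK'.
destruct (in_N_family_disc_bound c r b' hr Hb1 _ K
  (fun j => in_N_laplacian_iter _ w j Hs HCR)) as [h1 [Hh1 [Hh1p Hlap]]].
destruct (in_N_family_disc_bound c r b' hr Hb1 _ K
  (fun j => in_N_CR_defect_iter _ w j Hs HCR)) as [h2 [Hh2 [Hh2p HCRj]]].
destruct (negligible_family_bound (fun j e => Nat.iter j Dx (w e) (c e)) K
  (fun j _ => Hjet j)) as [h3 [Hh3 [Hh3p Hj]]].
set (h := fun e => h1 e + (h2 e + h3 e)).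
assert (Hh : real_negligible h) by (now repeat apply real_negligible_plus).
set (rho := fun e : index => Rpower e b).
(* With this [d], the [K] gradient estimates use up [2 * d * K], which is half of the radius
   [eps^b']; [q] is [4 / d]. *)
set (q := fun e : index => 16 * INR K * Rpower e (- b')).
set (d := fun e : index => / (4 * INR K) * Rpower e b').
assert (Hqd : forall e, 4 / d e = q e).
{ intros e; unfold d, q; rewrite Rpower_Ropp; field; split; [| lra].
  apply Rgt_not_eq, Rpower_pos. }
assert (Hmr : real_moderate rho) by apply real_moderate_Rpower.
assert (Hmq : real_moderate q).
{ apply real_moderate_mult; [apply real_moderate_const | apply real_moderate_Rpower]. }
assert (Hmd : real_moderate d).
{ apply real_moderate_mult; [apply real_moderate_const | apply real_moderate_Rpower]. }
(* [T] collects every factor of [h] in the final bound. It is moderate because [K] is fixed, so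
   [T * h] is negligible. *)
set (T := fun e => (4 * rho e) ^ K * (INR K * (1 + q e) ^ K * d e) +
  INR K * (1 + 4 * rho e) ^ K).
assert (HT : real_moderate T).
{ unfold T; repeat first [assumption | apply real_moderate_plus | apply real_moderate_mult
    | apply real_moderate_pow | apply real_moderate_const]. }
assert (HTh := real_negligible_le _ (S m) (real_negligible_mult _ _ HT Hh)).
generalize (for_small_and _ _ (for_small_and _ _ (for_small_and _ _ HTh HN)
  (for_small_and _ _ Hxb (for_small_Rpower_mult_le b' b 2 Hb2)))
  (for_small_and _ _ (for_small_le (/ 2) ltac:(lra))
    (for_small_le (/ (64 * INR K) ^ K)
      (Rinv_0_lt_compat _ (pow_lt (64 * INR K) K ltac:(lra)))))).
apply for_small_imp; intros e [[[H1 H2] [H3 H4]] [H5 H6]].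
assert (Hd0 : 0 < d e).
{ apply Rmult_lt_0_compat; [apply Rinv_0_lt_compat; lra | apply Rpower_pos]. }
assert (Hh0 : 0 <= h e /\ h1 e <= h e /\ h2 e <= h e /\ h3 e <= h e).
{ unfold h; generalize (Hh1p e) (Hh2p e) (Hh3p e); lra. }
assert (HdK : 2 * d e * INR K = Rpower e b' / 2) by (unfold d; field; lra).
assert (HD := iterated_Dx_bound (w e) (c e) (Rpower e b') (d e) (M e) (h e) K Hd0
  (proj1 Hh0) (Hs e) (HwM e)
  (fun j z Hjk Hz => Rle_trans _ _ _ (Hlap e j z Hjk Hz) (proj1 (proj2 Hh0)))).
assert (Hrho : rho e <= Rpower e b') by (unfold rho; generalize (Rpower_pos e b); lra).
fold (rho e) in H4.
rewrite HdK, Hqd in HD.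
(* By [H4], [rho] is at most half of [eps^b'], so the Cauchy estimate [HD] holds on the whole disc
   of radius [rho]. *)
assert (HTb := taylor_bound K (w e) (c e) (rho e) _ (h e) (Hs e) (proj1 Hh0)
  (fun j Hjk => Rle_trans _ _ _ (Hj e j Hjk) (proj2 (proj2 (proj2 Hh0))))
  (fun j z Hjk Hz => Rle_trans _ _ _ (HCRj e j z Hjk (Rle_trans _ _ _ Hz Hrho))
    (proj1 (proj2 (proj2 Hh0))))
  (fun z Hz => HD z ltac:(lra)) (x e) H3).
apply Rle_trans with (1 := HTb).
replace ((4 * rho e) ^ K * (q e ^ K * M e + INR K * (1 + q e) ^ K * (h e * d e)) +
  INR K * (1 + 4 * rho e) ^ K * h e) with ((4 * rho e * q e) ^ K * M e + T e * h e)
  by (unfold T; rewrite Rpow_mult_distr; ring).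
apply eps_pow_sum_le; auto.
replace (4 * rho e * q e) with (64 * INR K * Rpower e (b - b')).
2: { unfold rho, q; replace (b - b') with (b + - b') by ring; rewrite Rpower_plus; ring. }
rewrite Rpow_mult_distr.
assert (Hpow : Rpower e (b - b') ^ K <= e ^ (N + S (S m))).
{ rewrite <- Rpower_pow by apply Rpower_pos; rewrite Rpower_mult.
  rewrite <- Rpower_pow by apply eps_range; apply Rpower_eps_le; lra. }
assert (HC : 0 < (64 * INR K) ^ K) by (apply pow_lt; lra).
assert (HCe : (64 * INR K) ^ K * e <= 1).
{ apply Rle_trans with ((64 * INR K) ^ K * / (64 * INR K) ^ K).
  - apply Rmult_le_compat_l; lra.
  - right; apply Rinv_r; lra. }
assert (HeN := eps_pow_pos e N).
apply Rle_trans with ((64 * INR K) ^ K * e ^ (N + S (S m)) * / e ^ N).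
- apply Rmult_le_compat; auto.
  + apply Rmult_le_pos; [lra | apply pow_le, Rlt_le, Rpower_pos].
  + apply Rmult_le_compat_l; lra.
- rewrite pow_add.
  replace ((64 * INR K) ^ K * (e ^ N * e ^ S (S m)) * / e ^ N)
    with ((64 * INR K) ^ K * e * e ^ S m) by (simpl; field; lra).
  rewrite <- (Rmult_1_l (e ^ S m)) at 2; apply Rmult_le_compat_r; auto.
  apply Rlt_le, eps_pow_pos.
Qed.

(** * Zeroes and jets *)

Lemma CR_defect_lin a f g : smooth f -> smooth g ->
  CR_defect (lin a f g) = lin a (CR_defect f) (CR_defect g).
Proof.
intros Hf Hg; unfold CR_defect; rewrite Dx_lin, Dy_lin by now apply smooth_partials.
apply functional_extensionality; intros z; unfold lin; ring.
Qed.

Lemma iter_Dx_lin j a f g : smooth f -> smooth g ->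
  Nat.iter j Dx (lin a f g) = lin a (Nat.iter j Dx f) (Nat.iter j Dx g).
Proof. exact (pder_lin j 0 a f g). Qed.

(* Taylor's bound for [f] minus the monomial [a (z - c)^k / k!], whose [k]-jet at [c] is small. *)
Lemma leading_jet_bound (f : C -> C) (c x : C) (k : nat) (M h : R) : smooth f -> 0 <= h ->
  (forall j, (j < k)%nat -> Cmod (Nat.iter j Dx f c) <= h) ->
  (forall j z, (j < S k)%nat -> Cmod (z - c)%C <= Cmod (x - c)%C ->
    Cmod (CR_defect (Nat.iter j Dx f) z) <= h) ->
  (forall z, Cmod (z - c)%C <= Cmod (x - c)%C -> Cmod (Nat.iter (S k) Dx f z) <= M) ->
  Cmod (Nat.iter k Dx f c) * Cmod (x - c)%C ^ k <=
  falling k k * (Cmod (f x) + ((4 * Cmod (x - c)%C) ^ S k * M +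
    INR (S k) * (1 + 4 * Cmod (x - c)%C) ^ S k * h)).
Proof.
intros Hf Hh Hjet HCR HM.
assert (HF := falling_diag_pos k).
set (a := Nat.iter k Dx f c) in *.
set (p := monomial (a / RtoC (falling k k))%C c k).
assert (HF0 : RtoC (falling k k) <> 0%C) by (intros E; apply RtoC_inj in E; lra).
assert (Hp : smooth p) by apply smooth_monomial.
assert (Hpj : forall j, Nat.iter j Dx p =
  monomial (RtoC (falling k j) * (a / RtoC (falling k k)))%C c (k - j)).
{ intros j; apply iter_Dx_monomial. }
assert (Hc : forall j, (j < S k)%nat ->
  Cmod (Nat.iter j Dx (lin (- (1))%C p f) c) <= h).
{ intros j Hj; rewrite iter_Dx_lin, Hpj by assumption; unfold lin, monomial.
  destruct (Nat.eq_dec j k) as [-> |Hne].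
  - rewrite Nat.sub_diag; fold a; simpl Cpow.
    replace (- (1) * (RtoC (falling k k) * (a / RtoC (falling k k)) * 1) + a)%C with (RtoC 0)
      by (field; exact HF0).
    now rewrite Cmod_0.
  (* For [j < k] the derivative of the monomial keeps a factor [c - c]. *)
  - destruct (k - j)%nat as [|n] eqn:E; [lia |]; simpl Cpow.
    match goal with |- Cmod ?z <= _ => replace z with (Nat.iter j Dx f c) by ring end.
    apply Hjet; lia. }
assert (HT := taylor_bound (S k) (lin (- (1))%C p f) c (Cmod (x - c)%C) M h
  (smooth_lin _ _ _ Hp Hf) Hh Hc).
assert (Hv : Cmod (lin (- (1))%C p f x) <= (4 * Cmod (x - c)%C) ^ S k * M +
  INR (S k) * (1 + 4 * Cmod (x - c)%C) ^ S k * h).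
{ apply HT; [| | apply Rle_refl].
  - intros j z Hj Hz; rewrite iter_Dx_lin, CR_defect_lin by auto using smooth_iter_Dx.
    unfold lin at 1; rewrite Hpj, CR_defect_monomial.
    match goal with |- Cmod ?w <= _ =>
      replace w with (CR_defect (Nat.iter j Dx f) z) by ring end.
    auto.
  (* The monomial has degree [k], so its derivative of order [k + 1] is 0. *)
  - intros z Hz; rewrite iter_Dx_lin by assumption; unfold lin at 1.
    rewrite Hpj, falling_gt by lia; unfold monomial.
    match goal with |- Cmod ?w <= _ =>
      replace w with (Nat.iter (S k) Dx f z) by ring end.
    auto. }
rewrite <- Cmod_pow, <- Cmod_mult.
(* The bracket is [p x], written as [f x] minus the Taylor remainder. *)
replace (a * Cpow (x - c) k)%C with (RtoC (falling k k) * (f x - lin (- (1)) p f x))%C.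
2: { unfold lin, p, monomial; field; exact HF0. }
rewrite Cmod_mult, Cmod_R, Rabs_pos_eq by lra.
apply Rmult_le_compat_l; [lra |].
apply Rle_trans with (1 := Cmod_triangle _ _); rewrite Cmod_opp; lra.
Qed.

(** The order of choices matters: the bound [M] on the derivative of order [k + 1] is taken on a
    fixed disc, and only afterwards is a zero [x] picked, so close to [c] that its distance beats
    [M]. The net [y] represents the inverse of [x - c]. *)
Lemma jet_vanishes_of_zeroes (c : mnet) (r : R) (hr : 0 < r) (w : index -> C -> C) :
  in_EM (sharp_ball (cls c) r) w ->
  in_N (sharp_ball (cls c) r) (fun e => CR_defect (w e)) ->
  (forall q : R, exists x y : mnet, for_small (fun e => Cmod (x e - c e)%C <= Rpower e q) /\
    negligible (fun e => (x e - c e) * y e - 1)%C /\ negligible (fun e => w e (x e))) ->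
  forall k, negligible (fun e => Nat.iter k Dx (w e) (c e)).
Proof.
intros Hw HCR Hacc k; induction k as [k IH] using lt_wf_ind.
assert (Hs : forall e, smooth (w e)) by apply Hw.
set (b := - ln r + 1); assert (Hb : - ln r < b) by (unfold b; lra); clearbody b.
destruct (in_EM_disc_bound c r b hr Hb _ (in_EM_iter_Dx _ w (S k) Hw)) as [M [HM [M0 HwM]]].
destruct (real_moderate_le M HM) as [N HN].
destruct (in_N_family_disc_bound c r b hr Hb _ (S k)
  (fun j => in_N_CR_defect_iter _ w j Hs HCR)) as [h2 [Hh2 [Hh2p HCRj]]].
destruct (negligible_family_bound (fun j e => Nat.iter j Dx (w e) (c e)) k IH)
  as [h3 [Hh3 [Hh3p Hj]]].
set (h := fun e => h2 e + h3 e).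
assert (Hh : real_negligible h) by now apply real_negligible_plus.
(* The first entry keeps [x] in the disc where the bounds hold. The second makes [rho * M] at most
   [eps^(m + 2)], with one power to absorb [C0] and one for the final sum. *)
intros m; set (q := Rmax b (INR (N + S (S m)))).
destruct (Hacc q) as [x [y [Hxq [Hxy Hwx]]]].
set (rho := fun e => Cmod (x e - c e)%C).
assert (Hrho : real_moderate rho).
{ apply real_moderate_Cmod; replace (fun e => x e - c e)%C with (net (mnet_plus x (mnet_opp c))).
  - apply net_moderate.
  - apply functional_extensionality; intros e; simpl; ring. }
assert (Hy : real_moderate (fun e => Cmod (y e))) by apply real_moderate_Cmod, net_moderate.
set (F := falling k k); assert (HF : 0 < F) by apply falling_diag_pos.
(* [T] collects the negligible contributions: the value at the zero and the error [h]. *)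
set (T := fun e => 2 ^ k * F * Cmod (y e) ^ k * (Cmod (w e (x e)) +
  INR (S k) * (1 + 4 * rho e) ^ S k * h e)).
assert (HT : real_negligible T).
{ apply real_negligible_mult; [| apply real_negligible_plus].
  - repeat first [assumption | apply real_moderate_mult
      | apply real_moderate_pow | apply real_moderate_const].
  - now apply real_negligible_Cmod.
  - apply real_negligible_mult; auto.
    repeat first [assumption | apply real_moderate_plus | apply real_moderate_mult
      | apply real_moderate_pow | apply real_moderate_const]. }
(* The last factor bounds [(rho * Y) ^ k]; the first compensates its lower bound [(/ 2) ^ k]; [F]
   and [4 ^ S k] come from [leading_jet_bound]. *)
set (C0 := 2 ^ k * F * 4 ^ S k * 2 ^ k).
assert (H2k : 0 < 2 ^ k) by (apply pow_lt; lra).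
assert (H4k : 0 < 4 ^ S k) by (apply pow_lt; lra).
assert (HC0 : 0 < C0) by (unfold C0; repeat (apply Rmult_lt_0_compat; [| assumption]); assumption).
generalize (for_small_and _ _ (for_small_and _ _ HN Hxq)
  (for_small_and _ _ (for_small_and _ _ (real_negligible_le _ (S m) HT) (Hxy 1%nat))
  (for_small_and _ _ (for_small_le (/ 2) ltac:(lra))
    (for_small_le (/ C0) (Rinv_0_lt_compat _ HC0))))).
apply for_small_imp; intros e [[H1 H2] [[H3 H4] [H5 H6]]]; rewrite pow_1 in H4.
fold (rho e) in H2.
assert (H2b : rho e <= Rpower e b).
{ apply Rle_trans with (1 := H2), Rpower_eps_le, Rmax_l. }
assert (Hh0 : 0 <= h e /\ h2 e <= h e /\ h3 e <= h e).
{ unfold h; generalize (Hh2p e) (Hh3p e); lra. }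
assert (HL := leading_jet_bound (w e) (c e) (x e) k (M e) (h e) (Hs e) (proj1 Hh0)
  (fun j Hjk => Rle_trans _ _ _ (Hj e j Hjk) (proj2 (proj2 Hh0)))
  (fun j z Hjk Hz => Rle_trans _ _ _ (HCRj e j z Hjk (Rle_trans _ _ _ Hz H2b))
    (proj1 (proj2 Hh0)))
  (fun z Hz => HwM e z (Rle_trans _ _ _ Hz H2b))).
fold (rho e) in HL; fold F in HL.
set (A := Cmod (Nat.iter k Dx (w e) (c e))) in *.
assert (HA : 0 <= A) by apply Cmod_ge_0.
set (Y := Cmod (y e)) in *; assert (HY : 0 <= Y) by apply Cmod_ge_0.
assert (Hr0 : 0 <= rho e) by apply Cmod_ge_0.
(* The product [(x - c) * y] differs from 1 by at most [e], hence by at most one half. Multiplying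
   by [2 ^ k * Y ^ k] can therefore replace the division by [rho ^ k]. *)
assert (HrY : / 2 <= rho e * Y <= 2).
{ unfold rho, Y; rewrite <- Cmod_mult; split.
  - generalize (Cmod_triangle ((x e - c e) * y e) (- ((x e - c e) * y e - 1))%C).
    replace ((x e - c e) * y e + - ((x e - c e) * y e - 1))%C with (RtoC 1) by ring.
    rewrite Cmod_opp, Cmod_1; lra.
  - generalize (Cmod_triangle 1 ((x e - c e) * y e - 1)%C).
    replace (1 + ((x e - c e) * y e - 1))%C with ((x e - c e) * y e)%C by ring.
    rewrite Cmod_1; lra. }
assert (Hlow : 1 <= 2 ^ k * (rho e * Y) ^ k).
{ rewrite <- Rpow_mult_distr; apply pow_R1_Rle; lra. }
assert (Hup : (rho e * Y) ^ k <= 2 ^ k) by (apply pow_incr; lra).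
assert (HYk : 0 <= Y ^ k) by now apply pow_le.
apply Rle_trans with (C0 * (rho e * M e) + T e).
- apply Rle_trans with (2 ^ k * Y ^ k * (A * rho e ^ k)).
  { rewrite Rpow_mult_distr in Hlow.
    replace (2 ^ k * Y ^ k * (A * rho e ^ k)) with (A * (2 ^ k * (rho e ^ k * Y ^ k))) by ring.
    rewrite <- (Rmult_1_r A) at 1; now apply Rmult_le_compat_l. }
  apply Rle_trans with (2 ^ k * Y ^ k * (F * (Cmod (w e (x e)) + ((4 * rho e) ^ S k * M e +
    INR (S k) * (1 + 4 * rho e) ^ S k * h e)))).
  { apply Rmult_le_compat_l; [apply Rmult_le_pos; lra | exact HL]. }
  (* Of the [k + 1] factors [rho] in the remainder, [k] are paired with [Y ^ k] and one survives. *)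
  replace (2 ^ k * Y ^ k * (F * (Cmod (w e (x e)) + ((4 * rho e) ^ S k * M e +
    INR (S k) * (1 + 4 * rho e) ^ S k * h e)))) with
    (2 ^ k * F * 4 ^ S k * (rho e * Y) ^ k * (rho e * M e) + T e).
  + apply Rplus_le_compat_r; apply Rmult_le_compat_r; [apply Rmult_le_pos; auto |].
    unfold C0; apply Rmult_le_compat_l; auto.
    repeat (apply Rmult_le_pos; [| lra]); lra.
  + unfold T; fold Y; rewrite !(Rpow_mult_distr _ (rho e)), Rpow_mult_distr.
    change (rho e ^ S k) with (rho e * rho e ^ k); ring.
- apply eps_pow_sum_le; auto.
  assert (Hrq : rho e <= e ^ (N + S (S m))).
  { apply Rle_trans with (1 := H2); rewrite <- Rpower_pow by apply eps_range.
    apply Rpower_eps_le, Rmax_r. }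
  assert (HeN := eps_pow_pos e N).
  apply Rle_trans with (C0 * (e ^ (N + S (S m)) * / e ^ N)).
  + apply Rmult_le_compat_l; [lra |]; now apply Rmult_le_compat.
  + rewrite pow_add.
    replace (C0 * (e ^ N * e ^ S (S m) * / e ^ N)) with (C0 * e * e ^ S m)
      by (simpl; field; lra).
    assert (HCe : C0 * e <= 1).
    { apply Rle_trans with (C0 * / C0); [apply Rmult_le_compat_l; lra | right; apply Rinv_r; lra]. }
    rewrite <- (Rmult_1_l (e ^ S m)) at 2; apply Rmult_le_compat_r; auto.
    apply Rlt_le, eps_pow_pos.
Qed.

(** Since [Dy] is [Ci] times [Dx] plus the defect, each [y]-derivative can be traded for an
    [x]-derivative up to a negligible term. The induction on [b] therefore passes from [w] to
    [Dx w]. *)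
Lemma in_N_of_iter_Dx A b w : (forall e, smooth (w e)) ->
  in_N A (fun e => CR_defect (w e)) ->
  (forall a (x : mnet), A (cls x) -> negligible (fun e => Nat.iter a Dx (w e) (x e))) ->
  forall a (x : mnet), A (cls x) -> negligible (fun e => pder a b (w e) (x e)).
Proof.
revert w; induction b as [|b IH]; intros w Hs HCR H a x Hx; [now apply H |].
assert (E : forall e, pder a (S b) (w e) =
  lin Ci (pder a b (Dx (w e))) (pder a b (CR_defect (w e)))).
{ intros e; rewrite <- pder_Dy, <- pder_lin by
    (unfold CR_defect; auto using smooth_lin, smooth_Dx, smooth_Dy).
  f_equal; apply functional_extensionality; intros z; unfold CR_defect, lin; ring. }
apply negligible_ext with
  (z := fun e => (Ci * pder a b (Dx (w e)) (x e) + pder a b (CR_defect (w e)) (x e))%C).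
{ intros e; now rewrite E. }
apply negligible_plus; [| now apply HCR].
apply negligible_mult; [apply moderate_const |].
apply (IH (fun e => Dx (w e))); auto.
- intros e; now apply smooth_Dx.
- apply (in_N_CR_defect_iter A w 1 Hs HCR).
- intros i y Hy; generalize (H (S i) y Hy); apply negligible_ext.
  intros e; now rewrite Nat.iter_succ_r.
Qed.

(** * From nets to classes *)

Lemma gC_cls_eq_zero (z : mnet) : (cls z : gC) = zero <-> negligible z.
Proof.
change (@zero gC_AbelianMonoid) with (cls (mnet_const 0) : gC).
rewrite (cls_eq net_equiv_is_equiv); unfold net_equiv.
split; apply negligible_ext; intros e; simpl; ring.
Qed.

Lemma gF_eval_eq_zero {A : gC -> Prop} (v : fnet A) (x : mnet) (hx : A (cls x)) :
  gF_eval (cls v) (cls x) hx = zero <-> negligible (fun e => v e (x e)).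
Proof. rewrite gF_eval_cls; apply gC_cls_eq_zero. Qed.

Lemma Dk_cls {A} k (w : fnet A) : exists v : fnet A,
  (forall e, v e = Nat.iter k Dx (w e)) /\ Dk k (cls w) = cls v.
Proof.
induction k as [|k [v [Hv IH]]].
- now exists w.
- exists (fnet_Dx v); split; [intros e; simpl; now rewrite Hv |].
  unfold Dk in *; simpl; now rewrite IH, gF_Dx_cls.
Qed.

Lemma holomorphic_cls {A} (w : fnet A) : holomorphic (cls w) ->
  in_N A (fun e => CR_defect (w e)).
Proof.
unfold holomorphic, dbar.
rewrite gF_Dx_cls, gF_Dy_cls, gF_scal_cls, gF_plus_cls, gF_scal_cls.
unfold gF_0; rewrite (cls_eq (fnet_equiv_is_equiv A)); unfold fnet_equiv; intros H.
(* The factor [- 2 i] turns the representative of [dbar] into the defect. *)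
generalize (in_N_lin A (- Ci * 2)%C _ _ H (in_N_0 A)); apply in_N_ext; intros e z.
unfold CR_defect, lin; simpl.
assert (Hi : (Ci * Ci)%C = (- (1))%C).
{ unfold Ci, Cmult, Copp, RtoC; simpl; f_equal; ring. }
replace (- Ci * 2 * (/ 2 * (Dx (w e) z + Ci * Dy (w e) z) - 0) + 0)%C
  with (- Ci * Dx (w e) z - (Ci * Ci) * Dy (w e) z)%C.
- rewrite Hi; ring.
- field; intros E; apply RtoC_inj in E; lra.
Qed.

(** The witness is [c + eps^q]: its difference from [c] has the inverse [eps^(- q)], and [q] is
    taken large enough for both radii [r] and [s]. *)
Lemma zero_strict_accumulation (c : mnet) (r : R) : 0 < r ->
  strict_accumulation_point (zeroes (gF_0 (sharp_ball (cls c) r))) (cls c).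
Proof.
intros hr s Hs.
set (q := Rmax (- ln r) (- ln s) + 1).
assert (Hq : - ln r < q /\ - ln s < q).
{ unfold q; generalize (Rmax_l (- ln r) (- ln s)) (Rmax_r (- ln r) (- ln s)); lra. }
clearbody q.
set (p := MNet _ (real_moderate_Rpower q)); set (p' := MNet _ (real_moderate_Rpower (- q))).
assert (Hpq : for_small (fun e => Cmod (mnet_plus c p e - c e)%C <= Rpower e q)).
{ apply for_small_all; intros e; simpl.
  replace (c e + RtoC (Rpower e q) - c e)%C with (RtoC (Rpower e q)) by ring.
  rewrite Cmod_R, Rabs_pos_eq by apply Rlt_le, Rpower_pos; apply Rle_refl. }
assert (Hdiff : minus (cls (mnet_plus c p) : gC) (cls c) = cls p).
{ unfold minus, plus, opp; simpl; rewrite gC_opp_cls, gC_plus_cls.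
  apply gC_eq; intros e; simpl; ring. }
assert (Hball : sharp_ball (cls c) r (cls (mnet_plus c p))).
{ apply sharp_norm_lt_iff; auto; exists q; tauto. }
exists (cls (mnet_plus c p)); split; [| split].
- exists Hball; unfold gF_0; rewrite gF_eval_eq_zero; apply negligible_0.
- rewrite Hdiff; exists (cls p'); unfold mult, one; simpl; rewrite !gC_mult_cls.
  split; apply gC_eq; intros e; simpl; rewrite <- RtoC_mult, <- Rpower_plus;
    [rewrite Rplus_opp_r | rewrite Rplus_opp_l]; rewrite Rpower_O; auto; apply eps_range.
- apply sharp_norm_lt_iff; auto; exists q; tauto.
Qed.

(** [vanishing_of_jet] is applied to each iterated [x]-derivative of [w], whose jet at [c] is a
    shift of that of [w]. [in_N_of_iter_Dx] then covers the mixed derivatives. *)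
Lemma gF_eq_0_of_jet (c : mnet) (r : R) (hr : 0 < r) (w : fnet (sharp_ball (cls c) r)) :
  holomorphic (cls w) -> (forall k, negligible (fun e => Nat.iter k Dx (w e) (c e))) ->
  cls w = gF_0 (sharp_ball (cls c) r).
Proof.
intros hu H; assert (HCR := holomorphic_cls w hu).
assert (Hs : forall e, smooth (w e)) by apply (fn_EM w).
apply (cls_eq (fnet_equiv_is_equiv _)); unfold fnet_equiv; simpl.
apply in_N_ext with (u := w); [intros e z; ring |].
split; auto; intros a b x Hx; revert a x Hx; apply in_N_of_iter_Dx; auto.
intros a x Hx.
apply (vanishing_of_jet c r hr (fun e => Nat.iter a Dx (w e))); auto.
- apply in_EM_iter_Dx, fn_EM.
- now apply in_N_CR_defect_iter.
- intros k; generalize (H (k + a)%nat); apply negligible_ext; intros e.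
  now rewrite Nat.iter_add.
Qed.

Lemma jet_of_strict_accumulation (c : mnet) (r : R) (hr : 0 < r)
    (w : fnet (sharp_ball (cls c) r)) :
  holomorphic (cls w) -> strict_accumulation_point (zeroes (cls w)) (cls c) ->
  forall k, negligible (fun e => Nat.iter k Dx (w e) (c e)).
Proof.
intros hu Hacc; apply (jet_vanishes_of_zeroes c r hr); [apply fn_EM | now apply holomorphic_cls |].
(* A sharp norm below [exp (- q)] means a bound by [eps^b] for some [b > q]. *)
intros q; destruct (Hacc (exp (- q)) (exp_pos _)) as [z [[hz Hz] [[y [Hy _]] Hnorm]]].
revert hz Hz y Hy Hnorm; pattern z; revert z; refine (gC_ind _ _); intros x hx Hx.
refine (gC_ind _ _); intros y Hy Hnorm.
exists x, y; split; [| split].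
- apply sharp_norm_lt_iff in Hnorm; [| apply exp_pos]; destruct Hnorm as [b [Hb Hxb]].
  rewrite ln_exp, Ropp_involutive in Hb.
  revert Hxb; apply for_small_imp; intros e He; apply Rle_trans with (1 := He).
  apply Rpower_eps_le; lra.
- unfold minus, plus, opp, mult, one in Hy; simpl in Hy.
  rewrite gC_opp_cls, gC_plus_cls, gC_mult_cls in Hy.
  apply (cls_eq net_equiv_is_equiv) in Hy; unfold net_equiv in Hy.
  revert Hy; apply negligible_ext; intros e; simpl; ring.
- now apply gF_eval_eq_zero in Hx.
Qed.

Theorem theorem4p24 (z0 : gC) (r : R) (hr : 0 < r) (u : gF (sharp_ball z0 r))
    (hu : holomorphic u) :
  (strict_accumulation_point (zeroes u) z0 <->
     forall k : nat, gF_eval (Dk k u) z0 (sharp_ball_center z0 r hr) = zero) /\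
  ((forall k : nat, gF_eval (Dk k u) z0 (sharp_ball_center z0 r hr) = zero) <->
     u = gF_0 (sharp_ball z0 r)).
Proof.
(* The membership proof is generalized first, so that its type follows when [z0] is replaced by a
   class [cls c]. *)
revert u hu; generalize (sharp_ball_center z0 r hr).
pattern z0; revert z0; refine (gC_ind _ _); intros c hc u hu.
rewrite <- (cls_repr u) in *; set (w := repr u) in *; clearbody w; clear u.
assert (Hjet : (forall k, gF_eval (Dk k (cls w)) (cls c) hc = zero) <->
  (forall k, negligible (fun e => Nat.iter k Dx (w e) (c e)))).
{ assert (E : forall k, gF_eval (Dk k (cls w)) (cls c) hc = zero <->
    negligible (fun e => Nat.iter k Dx (w e) (c e))).
  { intros k; destruct (Dk_cls k w) as [v [Hv ->]]; rewrite gF_eval_eq_zero.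
    split; apply negligible_ext; intros e; now rewrite Hv. }
  split; intros H k; now apply E. }
assert (H23 : (forall k, gF_eval (Dk k (cls w)) (cls c) hc = zero) ->
  cls w = gF_0 (sharp_ball (cls c) r)).
{ intros H; apply gF_eq_0_of_jet; auto; now apply Hjet. }
assert (H31 : cls w = gF_0 (sharp_ball (cls c) r) ->
  strict_accumulation_point (zeroes (cls w)) (cls c)).
{ intros ->; now apply zero_strict_accumulation. }
assert (H12 : strict_accumulation_point (zeroes (cls w)) (cls c) ->
  forall k, gF_eval (Dk k (cls w)) (cls c) hc = zero).
{ intros H; apply Hjet; now apply jet_of_strict_accumulation with (1 := hr). }
(* The implications [H12], [H23] and [H31] form a cycle, which gives both equivalences. *)
split; split; auto.
Qed.
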